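(* Let $N$ be a natural number and $d$ a divisor of $N$. Let $\zeta\in\mathbb{C}$ be a primitive $d$-th root of unity, $q\in\mathbb{C}$ a primitive $N$-th root of unity, and $c$ an integer with $q^c=\zeta$. Consider the complex Hopf algebras $$\hat T_{\zeta,q}=\langle x,g\mid g^N=1,\ x^d=0,\ gx=\zeta xg\rangle,\quad \Delta(g)=g\otimes g,\ \Delta(x)=g\otimes x+x\otimes 1,$$ $$\check T_{\zeta,q}=\langle x,g\mid g^N=1,\ x^d=0,\ gx=q\,xg\rangle,\quad \Delta(g)=g\otimes g,\ \Delta(x)=g^c\otimes x+x\otimes 1.$$ Let $A\subset\hat T_{\zeta,q}$ and $B\subset\check T_{\zeta,q}$ be the Hopf subalgebras generated by the respective elements $g$ (both isomorphic to the group algebra $\mathbb{C}[\mathbb{Z}_N]$), and let $\omega:A\otimes B\to\mathbb{C}$ be the non-degenerate Hopf pairing $\omega(g^n\otimes g^m)=q^{nm}$. Then: (1) The algebra homomorphism $\pi:\hat T_{\zeta,q}\to A$ with $\pi(g)=g$ and $\pi(x)=0$ is a Hopf algebra projection. (2) The partial dualization of $\hat T_{\zeta,q}$ with respect to the partial dualization datum $(\hat T_{\zeta,q}\xrightarrow{\pi}A,B,\omega)$ is isomorphic, as a Hopf algebra, to $\check T_{\zeta,q}$.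
   Context: Partial dualization, for complex Hopf algebras (with invertible antipode). A partial dualization datum $(H\xrightarrow{\pi}A,B,\omega)$ consists of a Hopf algebra projection $\pi:H\to A$ onto a Hopf subalgebra $A\subset H$ (i.e. $\pi$ restricts to the identity on $A$), a Hopf algebra $B$ and a non-degenerate Hopf pairing $\omega:A\otimes B\to\mathbb{C}$, meaning $\omega(aa',b)=\omega(a',b_{(1)})\omega(a,b_{(2)})$, $\omega(1,b)=\varepsilon(b)$, $\omega(a,bb')=\omega(a_{(2)},b)\omega(a_{(1)},b')$, $\omega(a,1)=\varepsilon(a)$, together with an inverse copairing $\omega'(1)=\sum_i b_i\otimes a_i\in B\otimes A$ (so $\sum_i\omega(a,b_i)a_i=a$ and $\sum_i b_i\,\omega(a_i,b)=b$). For the pairing above, $\omega'(1)=\frac1N\sum_{k,\ell=1}^Nq^{-k\ell}g^k\otimes g^\ell$. The coinvariants $K=\{r\in H\mid r_{(1)}\otimes\pi(r_{(2)})=r\otimes1\}$ form a subalgebra of $H$ and a Hopf algebra in the braided category ${}_A^A\mathcal{YD}$ of left $A$-Yetter-Drinfel'd modules, with the left adjoint action $a.k=a_{(1)}kS(a_{(2)})$, coaction $\delta(k)=\pi(k_{(1)})\otimes k_{(2)}$ and comultiplication $\Delta_K(k)=k_{(1)}\pi(S_H(k_{(2)}))\otimes k_{(3)}$; and $H\cong K\rtimes A$. The braided equivalence $\Omega:{}_A^A\mathcal{YD}\to{}_B^B\mathcal{YD}$ sends $X$ to the vector space $X$ with $B$-action $b.x=\omega(x_{(-1)},S_B^{-2}(b))\,x_{(0)}$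 and $B$-coaction $x\mapsto\sum_iS_B^2(b_i)\otimes a_i.x$, and has monoidal structure $\Omega_2(X,Y):\Omega(X)\otimes\Omega(Y)\to\Omega(X\otimes Y)$, $x\otimes y\mapsto(y_{(-1)}.x)\otimes y_{(0)}$. Then $L:=\Omega(K)$, with multiplication $\mu_K\circ\Omega_2(K,K)$ and comultiplication $\Omega_2(K,K)^{-1}\circ\Delta_K$, is a Hopf algebra in ${}_B^B\mathcal{YD}$. The partial dualization is the Radford biproduct $L\rtimes B$: the Hopf algebra on $L\otimes B$ with $(h\otimes a)(k\otimes b)=h(a_{(1)}.k)\otimes a_{(2)}b$ and $\Delta(h\otimes a)=h_{(1)}\otimes(h_{(2)})_{(-1)}a_{(1)}\otimes(h_{(2)})_{(0)}\otimes a_{(2)}$, where $\Delta_L(h)=h_{(1)}\otimes h_{(2)}$. *)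

(* Defs.v *)
From HB Require Import structures.
From mathcomp Require Import all_boot all_order all_algebra.
From mathcomp Require Import boolp classical_sets reals.
From mathcomp Require Import complex.

Set Implicit Arguments.
Unset Strict Implicit.
Unset Printing Implicit Defensive.

Import GRing.Theory.
Local Open Scope ring_scope.
Local Open Scope quotient_scope.

(* Tensor products of arbitrary vector spaces.  An element of [U ⊗ V] is a
   finite formal sum of pairs; two formal sums are identified when no bilinear
   map distinguishes them, so the universal property holds by construction. *)

Section Tensor.
Variables (F : fieldType) (U V : lmodType F).

Definition tsum (W : lmodType F) (f : U -> V -> W) (s : seq (U * V)) : W :=
  \sum_(p <- s) f p.1 p.2.

Definition tens_rel (s t : seq (U * V)) : bool :=
  `[< forall (W : lmodType F) (f : U -> V -> W),
        bilinear_for *:%R *:%R f -> tsum f s = tsum f t >].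

Lemma tens_rel_equiv : equiv_class_of tens_rel.
Proof.
split=> [s|s t|t s u].
- exact/asboolP.
- by apply/asboolP/asboolP => h W f bf; rewrite h.
- by move=> /asboolP h1 /asboolP h2; apply/asboolP => W f bf; rewrite h1 ?h2.
Qed.

Canonical tens_equiv := EquivRelPack tens_rel_equiv.

Definition tens : Type := {eq_quot tens_rel}.
HB.instance Definition _ := Choice.on tens.
HB.instance Definition _ := Quotient.on tens.
HB.instance Definition _ := EqQuotient.on tens.

Lemma tens_eqP (s t : seq (U * V)) :
  (forall (W : lmodType F) (f : U -> V -> W),
     bilinear_for *:%R *:%R f -> tsum f s = tsum f t) ->
  \pi_tens s = \pi_tens t.
Proof. by move=> h; apply/eqmodP/asboolP. Qed.

Definition tensor (u : U) (v : V) : tens := \pi_tens [:: (u, v)].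

(* The linear map on [tens] induced by [f]; meaningful for bilinear [f]. *)
Definition tlift (W : lmodType F) (f : U -> V -> W) (t : tens) : W :=
  tsum f (repr t).

Lemma tlift_pi (W : lmodType F) (f : U -> V -> W) s :
  bilinear_for *:%R *:%R f -> tlift f (\pi_tens s) = tsum f s.
Proof.
move=> bf; rewrite /tlift.
have /eqmodP /asboolP -> // : repr (\pi_tens s) = s %[mod tens].
by rewrite reprK.
Qed.

Definition tens0 : tens := \pi_tens [::].
Definition tens_add (t t' : tens) : tens := \pi_tens (repr t ++ repr t').
Definition seq_scale (a : F) (s : seq (U * V)) := [seq (a *: p.1, p.2) | p <- s].
Definition tens_scale (a : F) (t : tens) : tens := \pi_tens (seq_scale a (repr t)).
Definition tens_opp (t : tens) : tens := tens_scale (-1) t.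

Lemma tsum_cat (W : lmodType F) (f : U -> V -> W) s t :
  tsum f (s ++ t) = tsum f s + tsum f t.
Proof. exact: big_cat. Qed.

Lemma tsum_scale (W : lmodType F) (f : U -> V -> W) a s :
  bilinear_for *:%R *:%R f -> tsum f (seq_scale a s) = a *: tsum f s.
Proof.
move=> bf; rewrite /tsum big_map scaler_sumr; apply: eq_bigr => p _ /=.
have h (v : V) : linear_for *:%R (f^~ v) by apply: bf.1.
by have := @scalable_linear _ _ _ _ _ (h p.2) a p.1.
Qed.

Lemma tens_ext (t t' : tens) :
  (forall (W : lmodType F) (f : U -> V -> W),
     bilinear_for *:%R *:%R f -> tlift f t = tlift f t') -> t = t'.
Proof. by move=> h; rewrite -[t]reprK -[t']reprK; apply: tens_eqP. Qed.

Lemma tlift0 (W : lmodType F) (f : U -> V -> W) :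
  bilinear_for *:%R *:%R f -> tlift f tens0 = 0.
Proof. by move=> bf; rewrite tlift_pi // /tsum big_nil. Qed.

Lemma tlift_add (W : lmodType F) (f : U -> V -> W) t t' :
  bilinear_for *:%R *:%R f -> tlift f (tens_add t t') = tlift f t + tlift f t'.
Proof. by move=> bf; rewrite tlift_pi // tsum_cat. Qed.

Lemma tlift_scale (W : lmodType F) (f : U -> V -> W) a t :
  bilinear_for *:%R *:%R f -> tlift f (tens_scale a t) = a *: tlift f t.
Proof. by move=> bf; rewrite tlift_pi // tsum_scale. Qed.

Definition tliftE := (tlift_add, tlift_scale, tlift0).

Lemma tens_addA : associative tens_add.
Proof. by move=> x y z; apply: tens_ext => W f bf; rewrite !tliftE // addrA. Qed.
Lemma tens_addC : commutative tens_add.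
Proof. by move=> x y; apply: tens_ext => W f bf; rewrite !tliftE // addrC. Qed.
Lemma tens_add0 : left_id tens0 tens_add.
Proof. by move=> x; apply: tens_ext => W f bf; rewrite !tliftE // add0r. Qed.
Lemma tens_addN : left_inverse tens0 tens_opp tens_add.
Proof.
move=> x; apply: tens_ext => W f bf.
by rewrite !tliftE // scaleN1r addNr.
Qed.

HB.instance Definition _ :=
  GRing.isZmodule.Build tens tens_addA tens_addC tens_add0 tens_addN.

Lemma tens_scaleA a b t :
  tens_scale a (tens_scale b t) = tens_scale (a * b) t.
Proof. by apply: tens_ext => W f bf; rewrite !tliftE // scalerA. Qed.
Lemma tens_scale1 : left_id 1 tens_scale.
Proof. by move=> t; apply: tens_ext => W f bf; rewrite !tliftE // scale1r. Qed.
Lemma tens_scaleDr : right_distributive tens_scale +%R.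
Proof.
by move=> a x y; apply: tens_ext => W f bf; rewrite !tliftE // scalerDr.
Qed.
Lemma tens_scaleDl t : {morph tens_scale^~ t : a b / a + b}.
Proof.
by move=> a b; apply: tens_ext => W f bf; rewrite !tliftE // scalerDl.
Qed.

HB.instance Definition _ := GRing.Zmodule_isLmodule.Build F tens
  tens_scaleA tens_scale1 tens_scaleDr tens_scaleDl.

Lemma tlift_linear (W : lmodType F) (f : U -> V -> W) :
  bilinear_for *:%R *:%R f -> linear (tlift f).
Proof. by move=> bf a x y; rewrite [LHS]tlift_add // tlift_scale. Qed.

Lemma tensor_bilinear : bilinear_for *:%R *:%R tensor.
Proof.
split=> [v a x y|u a x y] /=; apply: tens_ext => W f bf;
  rewrite [RHS]tlift_add // tlift_scale // !tlift_pi // /tsum !big_seq1 /=.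
- by have := bf.1 v a x y.
- by have := bf.2 u a x y.
Qed.

End Tensor.

Notation "U ⊗ V" := (tens U V) (at level 40, left associativity) : type_scope.
Notation "u ⊗ v" := (tensor u v) (at level 40, left associativity) : ring_scope.

(* Sweedler notation: [e], bilinear in [a] and [b], applied to [t = a ⊗ b]. *)
Notation "\sw_ ( a , b <- t ) e" := (tlift (fun a b => e) t)
  (at level 41, e at level 41, a binder, b binder, t at level 40,
   format "\sw_ ( a ,  b  <-  t )  e") : ring_scope.

Definition tmap (F : fieldType) (U V U' V' : lmodType F)
    (f : U -> U') (g : V -> V') (t : U ⊗ V) : U' ⊗ V' :=
  \sw_(u, v <- t) (f u ⊗ g v).

Lemma tmap_linear (F : fieldType) (U V U' V' : lmodType F)
  (f : {linear U -> U'}) (g : {linear V -> V'}) : linear (tmap f g).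
Proof.
apply: tlift_linear; split=> [v|u] a x y /=; rewrite linearP.
- exact: (tensor_bilinear _ _).1.
- exact: (tensor_bilinear _ _).2.
Qed.

Section Hopf.
Variable F : fieldType.

Record hopfAlgebra := HopfAlgebra {
  hopf_alg :> algType F;
  comul : {linear hopf_alg -> (hopf_alg ⊗ hopf_alg)%type};
  counit : {lrmorphism hopf_alg -> F^o};
  antipode : {linear hopf_alg -> hopf_alg};
  antipodeV : hopf_alg -> hopf_alg;
  comul1 : comul 1 = 1 ⊗ 1;
  comulM : forall h k : hopf_alg,
    comul (h * k) = \sw_(h1, h2 <- comul h) \sw_(k1, k2 <- comul k)
                      (h1 * k1) ⊗ (h2 * k2);
  comulA : forall h : hopf_alg,
    \sw_(h1, h2 <- comul h) \sw_(h21, h22 <- comul h2) h1 ⊗ (h21 ⊗ h22)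
    = \sw_(h1, h2 <- comul h) \sw_(h11, h12 <- comul h1) h11 ⊗ (h12 ⊗ h2);
  counitl : forall h : hopf_alg,
    \sw_(h1, h2 <- comul h) (counit h1 : F) *: h2 = h;
  counitr : forall h : hopf_alg,
    \sw_(h1, h2 <- comul h) (counit h2 : F) *: h1 = h;
  antipodel : forall h : hopf_alg,
    \sw_(h1, h2 <- comul h) antipode h1 * h2 = (counit h : F)%:A;
  antipoder : forall h : hopf_alg,
    \sw_(h1, h2 <- comul h) h1 * antipode h2 = (counit h : F)%:A;
  antipodeK : cancel antipode antipodeV;
  antipodeVK : cancel antipodeV antipode
}.

Arguments comul {_}.
Arguments counit {_}.
Arguments antipode {_}.
Arguments antipodeV {_}.

(* Compatibility with the antipodes is automatic. *)
Definition hopf_morphism (H H' : hopfAlgebra) (f : {lrmorphism H -> H'}) :=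
  (forall h, comul (f h) = tmap f f (comul h)) /\
  (forall h, counit (f h) = counit h).

Definition generates_algebra (T : algType F) (g : T) :=
  forall S : {pred T}, GRing.subalg_closed S -> g \in S -> forall t, t \in S.

(* A Hopf subalgebra of [H] is given by an injective morphism [i : A -> H];
   it is generated by the element [i gA]. *)
Definition hopf_subalgebra_generated_by (A H : hopfAlgebra)
    (i : {lrmorphism A -> H}) (gA : A) (g : H) :=
  [/\ hopf_morphism i, injective i, i gA = g & generates_algebra gA].

(* [T] is the unital algebra presented by generators [x], [g] and the relations
   g^N = 1, x^d = 0, g x = z x g. *)
Definition qrelations (N d : nat) (z : F) (T : algType F) (x g : T) :=
  [/\ g ^+ N = 1, x ^+ d = 0 & g * x = z *: (x * g)].

Definition qpresented (N d : nat) (z : F) (T : algType F) (x g : T) :=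
  [/\ qrelations N d z x g,
      (forall (E : algType F) (x' g' : E), qrelations N d z x' g' ->
         exists f : {lrmorphism T -> E}, f x = x' /\ f g = g')
    & (forall (E : algType F) (f f' : {lrmorphism T -> E}),
         f x = f' x -> f g = f' g -> f =1 f')].

(* The Hopf algebra with this presentation in which [g] is group-like and
   [x] is skew-primitive with respect to [g ^+ m].  As g^N = 1, an integer
   exponent c is represented by m = c mod N. *)
Definition is_taft (N d : nat) (z : F) (m : nat) (T : hopfAlgebra) (x g : T) :=
  [/\ qpresented N d z x g,
      comul g = g ⊗ g
    & comul x = (g ^+ m) ⊗ x + x ⊗ 1].

(* Bialgebra structure maps, without axioms.  Between Hopf algebras, bijective
   maps respecting these automatically commute with the antipodes; and any
   structure isomorphic to that of a Hopf algebra satisfies the axioms (and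
   has an antipode). *)
Record bialgData := BialgData {
  bd_space :> lmodType F;
  bd_mul : bd_space -> bd_space -> bd_space;
  bd_one : bd_space;
  bd_comul : bd_space -> bd_space ⊗ bd_space;
  bd_counit : bd_space -> F
}.

Definition bialg_of (H : hopfAlgebra) : bialgData :=
  @BialgData H *%R 1 comul counit.

Definition hopf_isomorphic (P Q : bialgData) :=
  exists f : {linear P -> Q},
    [/\ bijective f,
        forall a b, f (bd_mul a b) = bd_mul (f a) (f b),
        f (bd_one P) = bd_one Q,
        forall a, bd_comul (f a) = tmap f f (bd_comul a)
      & forall a, bd_counit (f a) = bd_counit a].

End Hopf.

Arguments comul {F _}.
Arguments counit {F _}.
Arguments antipode {F _}.
Arguments antipodeV {F _}.

(* The preimage of [y] under an injective [f] with [y] in its image. *)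
Definition preimage_of (F : fieldType) (U V : lmodType F) (f : U -> V) (y : V) : U :=
  xget 0 [set x | f x = y]%classic.

Section YetterDrinfeld.
Variable F : fieldType.

(* Structure maps of left-left Yetter-Drinfel'd modules and of bialgebras in
   that category, without the axioms, which the constructions below do not
   use. *)
Record ydData (A : hopfAlgebra F) := YDData {
  yd_space :> lmodType F;
  yd_act : A -> yd_space -> yd_space;
  yd_coact : yd_space -> A ⊗ yd_space
}.

Record ydBialgData (A : hopfAlgebra F) := YDBialgData {
  yb_yd :> ydData A;
  yb_mul : yb_yd ⊗ yb_yd -> yb_yd;
  yb_one : yb_yd;
  yb_comul : yb_yd -> yb_yd ⊗ yb_yd;
  yb_counit : yb_yd -> F
}.

Definition biproduct (B : hopfAlgebra F) (L : ydBialgData B) : bialgData F :=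
  @BialgData F (L ⊗ B)%type
    (fun s t => \sw_(h, a <- s) \sw_(k, b <- t) \sw_(a1, a2 <- comul a)
        yb_mul (h ⊗ yd_act a1 k) ⊗ (a2 * b))
    (yb_one L ⊗ 1)
    (fun s => \sw_(h, a <- s) \sw_(h1, h2 <- yb_comul h)
        \sw_(m, h0 <- yd_coact h2) \sw_(a1, a2 <- comul a)
        (h1 ⊗ (m * a1)) ⊗ (h0 ⊗ a2))
    (fun s => tlift (fun h a => yb_counit h * counit a : F^o) s).

End YetterDrinfeld.

Section PartialDual.
Variables (F : fieldType) (H A B : hopfAlgebra F).
Variables (i : {lrmorphism A -> H}) (pi : {lrmorphism H -> A}).
Variables (omega : {scalar (A ⊗ B)%type}) (w : B ⊗ A).

Definition hopf_projection :=
  [/\ hopf_morphism i, injective i, hopf_morphism pi & cancel i pi].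

Record hopf_pairing : Prop := HopfPairing {
  pairingMl : forall (a a' : A) (b : B),
    omega ((a * a') ⊗ b)
    = tlift (fun b1 b2 => omega (a' ⊗ b1) * omega (a ⊗ b2) : F^o) (comul b);
  pairing1l : forall b : B, omega (1 ⊗ b) = counit b;
  pairingMr : forall (a : A) (b b' : B),
    omega (a ⊗ (b * b'))
    = tlift (fun a1 a2 => omega (a2 ⊗ b) * omega (a1 ⊗ b') : F^o) (comul a);
  pairing1r : forall a : A, omega (a ⊗ 1) = counit a
}.

Definition nondegenerate :=
  (forall a : A, (forall b : B, omega (a ⊗ b) = 0) -> a = 0) /\
  (forall b : B, (forall a : A, omega (a ⊗ b) = 0) -> b = 0).

(* [w = \sum_i b_i ⊗ a_i] *)
Definition inverse_copairing :=
  (forall a : A, \sw_(bi, ai <- w) omega (a ⊗ bi) *: ai = a) /\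
  (forall b : B, \sw_(bi, ai <- w) omega (ai ⊗ b) *: bi = b).

Definition partial_dualization_datum :=
  [/\ hopf_projection, hopf_pairing, nondegenerate & inverse_copairing].

Definition coinvariant : {pred H} :=
  fun r => `[< tmap idfun pi (comul r) = r ⊗ 1 >].

Lemma coinvariant_submod : submod_closed coinvariant.
Proof.
have tl : linear (tmap (idfun : H -> H) pi).
  have h := @tmap_linear F H H H A idfun pi; exact h.
have t1 : linear (fun r : H => r ⊗ (1 : A)).
  by move=> a x y; exact: (tensor_bilinear _ _).1.
split=> [|a x y /asboolP hx /asboolP hy]; apply/asboolP.
  have := tl (-1) 0 0; have := t1 (-1) 0 0.
  by rewrite !scaler0 !addr0 !scaleN1r !addNr => -> <-; rewrite linear0.
by rewrite linearP tl t1 hx hy.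
Qed.

HB.instance Definition _ :=
  GRing.isSubmodClosed.Build F H coinvariant coinvariant_submod.

Record coinvariants := Coinvariant {
  coinv_val :> H;
  coinv_valP : coinv_val \in coinvariant
}.

HB.instance Definition _ := [isSub for coinv_val].
HB.instance Definition _ := [Choice of coinvariants by <:].
HB.instance Definition _ := [SubChoice_isSubLmodule of coinvariants by <:].

(* The sums below lie in [K], [A ⊗ K], [K ⊗ K], regarded as subspaces of
   [H], [A ⊗ H], [H ⊗ H]. *)
Definition K_yd : ydData A := @YDData F A coinvariants
  (fun a k => preimage_of coinv_val
     (\sw_(a1, a2 <- comul a) i a1 * coinv_val k * antipode (i a2)))
  (fun k => preimage_of (tmap idfun coinv_val)
     (\sw_(k1, k2 <- comul (coinv_val k)) pi k1 ⊗ k2)).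

Definition K_bialg : ydBialgData A := @YDBialgData F A K_yd
  (fun t => preimage_of coinv_val
     (tlift (fun h k : coinvariants => coinv_val h * coinv_val k) t))
  (preimage_of coinv_val 1)
  (fun k => preimage_of (tmap coinv_val coinv_val)
     (\sw_(k1, k' <- comul (coinv_val k)) \sw_(k2, k3 <- comul k')
        (k1 * i (pi (antipode k2))) ⊗ k3))
  (fun k => counit (coinv_val k)).

Definition Omega_yd (X : ydData A) : ydData B := @YDData F B X
  (fun b x => \sw_(a, x0 <- yd_coact x)
     omega (a ⊗ antipodeV (antipodeV b)) *: x0)
  (fun x => \sw_(bi, ai <- w) antipode (antipode bi) ⊗ yd_act ai x).

Definition Omega2 (X Y : ydData A) (t : X ⊗ Y) : X ⊗ Y :=
  \sw_(x, y <- t) \sw_(a, y0 <- yd_coact y) yd_act a x ⊗ y0.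

Definition Omega_bialg (X : ydBialgData A) : ydBialgData B :=
  @YDBialgData F B (Omega_yd X)
    (fun t => yb_mul (Omega2 t))
    (yb_one X)
    (fun x => preimage_of (@Omega2 X X) (yb_comul x))
    (@yb_counit F A X).

Definition partial_dualization : bialgData F := biproduct (Omega_bialg K_bialg).

End PartialDual.

(* The copairing inverse to [omega (gA ^+ n ⊗ gB ^+ m) = q ^+ (n * m)]. *)
Definition cyclic_copairing (F : fieldType) (A B : hopfAlgebra F)
    (N : nat) (q : F) (gA : A) (gB : B) : B ⊗ A :=
  N%:R^-1 *: \sum_(1 <= k < N.+1) \sum_(1 <= l < N.+1)
    q ^- (k * l) *: ((gB ^+ k) ⊗ (gA ^+ l)).

(* Main.v *)
Require Import Defs.
From mathcomp Require Import all_boot all_order all_algebra.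
From mathcomp Require Import reals.
From mathcomp Require Import complex.
From HB Require Import structures.
From mathcomp Require Import boolp classical_sets zify.
Import GRing.Theory.
Local Open Scope ring_scope.

Set Implicit Arguments.
Unset Strict Implicit.
Unset Printing Implicit Defensive.

(** The theorem holds because everything is diagonal in monomial bases.

    An algebra presented by [g ^+ N = 1], [x ^+ d = 0], [g * x = z *: (x * g)]
    has the basis [x ^+ i * g ^+ j] with [i < d] and [j < N]: the monomials
    span by the relations ([spans_presented]), and they are independent because
    [x] acts as a shift and [g] as a diagonal matrix on a [d]-dimensional space
    ([coordinates]).  The quantum binomial formula ([comul_skewX]) gives the
    comultiplication of every monomial.

    The projection kills [x], so its coinvariants [K] have the basis [x ^+ n]
    ([xK_spans]).  All structure maps of [K] are explicit on that basis, and so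
    are those of its image under the braided equivalence.  Both are instances
    of [quantum_line], a line of type [(a, r, mu)]: the group-like [g] acts on
    the basis vector [e n] by [a ^+ n], the coaction gives [e n] the degree
    [g ^+ (r * n)], and the multiplication is that of a truncated polynomial
    algebra twisted by [mu ^+ (n * m)].  Three lemmas then prove the theorem.

    - [K_quantum_line]: the coinvariants are a line of type [(zeta, 1, 1)].

    - [Omega_quantum_line]: dualizing along the pairing exchanges action and
      coaction, so that [(q ^+ s, r, mu)] becomes [(q ^+ r, s, q ^+ (s * r) * mu)].
      The new factor in the twist is the braiding scalar that the monoidal
      structure of the equivalence contributes.  With [zeta = q ^+ m], the
      dual of [K] has type [(q, m, zeta)].

    - [biproduct_quantum_line]: the biproduct of a line of type [(q, r, mu)]
      with the group algebra is the algebra presented with [z = q], in which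
      [x] is skew-primitive with respect to [g ^+ r].  The twist is a
      coboundary: it disappears when [e n] is sent to
      [mu ^- 'C(n, 2) *: x ^+ n], because
      ['C(n + m, 2) = 'C(n, 2) + 'C(m, 2) + n * m].

    The inverse copairing computes by Fourier inversion on the cyclic group
    ([fourier], [copairing_pickl]).  Structure maps that are defined as
    preimages are linear because the maps to be inverted are injective
    ([lin_preimage_of]).  The lemmas hold over any field: a primitive
    [N]-th root of unity already makes [N] invertible. *)

(** * Linear maps and tensor products *)

(** A plain proposition, in contrast to the bundled morphisms and to linearity
    relative to a scaling law: structure maps enter as anonymous Sweedler
    expressions, whose linearity [lintac] proves from the shape of the term. *)
Definition lin (F : fieldType) (U V : lmodType F) (f : U -> V) :=
  forall a x y, f (a *: x + y) = a *: f x + f y.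

Definition bilin (F : fieldType) (U V W : lmodType F) (f : U -> V -> W) :=
  (forall v, lin (f^~ v)) /\ (forall u, lin (f u)).

Section Linear.
Variable F : fieldType.
Implicit Types U V W : lmodType F.

Lemma lin_linear U V (f : {linear U -> V}) : lin f.
Proof. by move=> a x y; rewrite linearP. Qed.

Lemma lin0 U V (f : U -> V) : lin f -> f 0 = 0.
Proof. by move=> h; have := h (-1) 0 0; rewrite !scaleN1r !addNr. Qed.

Lemma linD U V (f : U -> V) : lin f -> {morph f : x y / x + y}.
Proof. by move=> h x y; have := h 1 x y; rewrite !scale1r. Qed.

Lemma linZ U V (f : U -> V) : lin f -> forall a x, f (a *: x) = a *: f x.
Proof. by move=> h a x; have := h a x 0; rewrite (lin0 h) !addr0. Qed.

Lemma lin_sum U V (f : U -> V) : lin f -> forall I r (P : pred I) E,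
  f (\sum_(i <- r | P i) E i) = \sum_(i <- r | P i) f (E i).
Proof. by move=> h I r P E; apply: big_morph; [apply: linD | apply: lin0]. Qed.

Lemma lin_id U : lin (fun x : U => x).
Proof. by []. Qed.

Lemma lin_comp U V W (f : V -> W) (g : U -> V) :
  lin f -> lin g -> lin (fun x => f (g x)).
Proof. by move=> hf hg a x y; rewrite hg hf. Qed.

Lemma lin_scalar U V (f : {scalar V}) (g : U -> V) :
  lin g -> lin (fun x => f (g x) : F^o).
Proof. by move=> hg a x y; rewrite hg linearP. Qed.

Lemma lin_compl U V V' W (f : V -> V' -> W) (g : U -> V) v :
  bilin f -> lin g -> lin (fun x => f (g x) v).
Proof. by move=> [h _] hg a x y; rewrite hg h. Qed.

Lemma lin_compr U V V' W (f : V' -> V -> W) (g : U -> V) v :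
  bilin f -> lin g -> lin (fun x => f v (g x)).
Proof. by move=> [_ h] hg a x y; rewrite hg h. Qed.

Lemma lin_bilinr U V W (f : U -> V -> W) u : bilin f -> lin (f u).
Proof. by case=> _ h; apply: h. Qed.

Lemma lin_bilinl U V W (f : U -> V -> W) v : bilin f -> lin (f^~ v).
Proof. by case=> h _; apply: h. Qed.

Lemma lin_bigsum U V I r (P : pred I) (f : I -> U -> V) :
  (forall i, lin (f i)) -> lin (fun x => \sum_(i <- r | P i) f i x).
Proof.
move=> h a x y; rewrite scaler_sumr -big_split; apply: eq_bigr => i _.
by rewrite h.
Qed.

Lemma bilin_scale V : bilin (fun (a : F^o) (v : V) => (a : F) *: v).
Proof.
split=> [v|u] a x y; first by rewrite scalerDl scalerA.
by rewrite scalerDr !scalerA mulrC.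
Qed.

Lemma bilin_mul (T : algType F) : bilin (fun a b : T => a * b).
Proof.
split=> [v|u] a x y; first by rewrite mulrDl scalerAl.
by rewrite mulrDr scalerAr.
Qed.

Lemma lin_mull U (T : algType F) (f : U -> T) c : lin f -> lin (fun x => f x * c).
Proof. exact: (lin_compl c (bilin_mul T)). Qed.

Lemma lin_mulr U (T : algType F) (f : U -> T) c : lin f -> lin (fun x => c * f x).
Proof. exact: (lin_compr c (bilin_mul T)). Qed.

Lemma lin_fmull U (f : U -> F^o) (c : F) : lin f -> lin (fun x => (f x : F) * c : F^o).
Proof. exact: lin_mull. Qed.

Lemma lin_fmulr U (f : U -> F^o) (c : F) : lin f -> lin (fun x => c * (f x : F) : F^o).
Proof. exact: lin_mulr. Qed.

Lemma lin_scalel U V (f : U -> F^o) (v : V) : lin f -> lin (fun x => (f x : F) *: v).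
Proof. exact: (lin_compl v (bilin_scale V)). Qed.

Lemma lin_scaler U V (f : U -> V) (c : F) : lin f -> lin (fun x => c *: f x).
Proof. exact: (lin_compr (f := fun (a : F^o) (v : V) => a *: v) c (bilin_scale V)). Qed.

Lemma bilin_tensor U V : bilin (@tensor F U V).
Proof. by split; [exact: (tensor_bilinear _ _).1|exact: (tensor_bilinear _ _).2]. Qed.

Lemma bilinP U V W (f : U -> V -> W) : bilin f -> bilinear_for *:%R *:%R f.
Proof. by case=> h1 h2; split=> [v|u] a x y; [apply: h1|apply: h2]. Qed.

Lemma lin_tlift U V W (f : U -> V -> W) : bilin f -> lin (tlift f).
Proof. by move=> /bilinP bf a x y; apply: tlift_linear. Qed.

Lemma lin_tlift_fun (X U V W : lmodType F) (f : X -> U -> V -> W) t :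
  (forall u v, lin (fun x => f x u v)) -> lin (fun x => tlift (f x) t).
Proof.
move=> h a x y; rewrite /tlift /tsum scaler_sumr -big_split.
by apply: eq_bigr => p _; rewrite h.
Qed.

Lemma tliftT U V W (f : U -> V -> W) u v : bilin f -> tlift f (u ⊗ v) = f u v.
Proof.
by move=> /bilinP bf; rewrite /tensor tlift_pi // /tsum big_seq1.
Qed.

End Linear.

(* Closes the leaves of [lintac]: bundled linear maps, partially applied
   bilinear maps, and linearity facts from the context. *)
Create HintDb lin.
#[export] Hint Resolve bilin_tensor bilin_mul bilin_scale : lin.

Ltac lin_base :=
  solve [ assumption | apply: lin_linear | eauto 2 with lin
        | apply: lin_bilinl; eauto 2 with lin
        | apply: lin_bilinr; eauto 2 with lin
        | match goal with H : _ |- _ => apply: H end ].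

(* A metavariable without [@] may capture the bound variable of the pattern, so
   every argument is matched as a function of [x] and then tested for being
   constant. *)
Ltac lintac :=
  cbv beta;
  lazymatch goal with
  | |- forall _, _ => let x := fresh "x" in intro x; lintac
  | |- bilin _ => first [ lin_base | split; lintac ]
  | |- lin (fun x => x) => apply: lin_id
  | |- lin (fun x => @GRing.scale _ _ (@?c x) (@?g x)) =>
      lazymatch c with
      | (fun _ => ?a) => apply: lin_scaler; lintac
      | _ => apply: lin_scalel; lintac
      end
  | |- lin (fun x => @GRing.mul _ (@?c x) (@?g x)) =>
      lazymatch c with
      | (fun _ => ?a) => first [apply: lin_mulr | apply: lin_fmulr]; lintac
      | _ => first [apply: lin_mull | apply: lin_fmull]; lintac
      end
  | |- lin (fun x => @tlift ?F ?U ?V ?W (@?f x) (@?t x)) =>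
      lazymatch f with
      | (fun _ => ?g) => apply: (lin_comp (f := @tlift F U V W g) (g := t));
                         [apply: lin_tlift|]; lintac
      | _ => apply: (@lin_tlift_fun F _ U V W f); lintac
      end
  | |- lin (fun x => \sum_(i <- _ | _) (@?f i x)) => apply: lin_bigsum; lintac
  | |- lin (fun x => @GRing.Linear.sort _ _ _ *%R ?h (@?g x)) =>
      apply: (lin_scalar h (g := g)); lintac
  | |- lin (fun x => ?h (@?f x) (@?g x)) =>
      first [ lin_base
            | lazymatch f with
              | (fun _ => ?v) => lazymatch g with
                | (fun x => x) => fail
                | _ => apply: (lin_comp (f := h v) (g := g)); lintac
                end
              | _ => lazymatch g with
                | (fun _ => ?v) => apply: (lin_compl (f := h) (g := f) v); lintac
                end
              end ]
  | |- lin (fun x => ?h (@?g x)) =>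
      first [lin_base | apply: (lin_comp (f := h) (g := g)); lintac]
  | |- lin _ => lin_base
  end.

(** The span as an induction principle, without coefficients: a property that
    is closed under linear combinations and holds on [e] holds on [v]. *)
Definition span (F : fieldType) (V : lmodType F) (I : Type) (e : I -> V) (v : V) :=
  forall P : V -> Prop, P 0 -> (forall a x y, P x -> P y -> P (a *: x + y)) ->
    (forall i, P (e i)) -> P v.

Definition spans (F : fieldType) (V : lmodType F) (I : Type) (e : I -> V) :=
  forall v, span e v.

Section Span.
Variable F : fieldType.
Implicit Types U V W : lmodType F.

Lemma span_mem V I (e : I -> V) i : span e (e i).
Proof. by move=> P _ _; apply. Qed.

Lemma span_lin V I (e : I -> V) a x y :
  span e x -> span e y -> span e (a *: x + y).
Proof. by move=> hx hy P P0 Pl Pe; exact: Pl (hx P P0 Pl Pe) (hy P P0 Pl Pe). Qed.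

Lemma span0 V I (e : I -> V) : span e 0.
Proof. by move=> P. Qed.

Lemma spanZ V I (e : I -> V) a x : span e x -> span e (a *: x).
Proof. by move=> hx; rewrite -[_ *: _]addr0; apply: span_lin => //; apply: span0. Qed.

Lemma span_sum V I (e : I -> V) J r (P : pred J) (f : J -> V) :
  (forall j, span e (f j)) -> span e (\sum_(j <- r | P j) f j).
Proof.
move=> h; apply: big_ind => [|x y hx hy|//]; first exact: span0.
by rewrite -[x]scale1r; apply: span_lin.
Qed.

(** The main tool: identities between linear maps are checked on generators. *)
Lemma spans_ext V W I (e : I -> V) (f g : V -> W) :
  spans e -> lin f -> lin g -> (forall i, f (e i) = g (e i)) -> forall v, f v = g v.
Proof.
move=> he hf hg h v; apply: (he v (fun v => f v = g v)) => //.
  by rewrite !lin0.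
by move=> a x y hx hy; rewrite hf hg hx hy.
Qed.

Lemma bilin_ext U V W I J (e : I -> U) (e' : J -> V) (f g : U -> V -> W) :
  spans e -> spans e' -> bilin f -> bilin g ->
  (forall i j, f (e i) (e' j) = g (e i) (e' j)) -> forall u v, f u v = g u v.
Proof.
move=> he he' hf hg h u v; move: u.
refine (spans_ext (f := f^~ v) (g := g^~ v) he _ _ _); [exact: hf.1 | exact: hg.1 |] => i.
by apply: (spans_ext he'); [exact: hf.2 | exact: hg.2 |].
Qed.

Lemma spans_tens U V I J (e : I -> U) (e' : J -> V) :
  spans e -> spans e' -> spans (fun ij : I * J => e ij.1 ⊗ e' ij.2).
Proof.
move=> he he' t.
pose E (ij : I * J) := e ij.1 ⊗ e' ij.2.
have pure u v : span E (u ⊗ v).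
  apply: (he u (fun u => span E (u ⊗ v))) => [|a x y hx hy|i].
  - by rewrite (lin0 (lin_bilinl v (bilin_tensor U V))); apply: span0.
  - by rewrite (lin_bilinl v (bilin_tensor U V)); exact: span_lin.
  apply: (he' v (fun v => span E (e i ⊗ v))) => [|a x y hx hy|j].
  - by rewrite (lin0 (lin_bilinr _ (bilin_tensor U V))); apply: span0.
  - by rewrite (lin_bilinr _ (bilin_tensor U V)); exact: span_lin.
  exact: (span_mem (e := E) (i, j)).
suff -> : t = \sum_(p <- repr t) p.1 ⊗ p.2.
  by apply: (span_sum (e := E)) => p; exact: pure.
apply: tens_ext => W f /[dup] bf [bf1 bf2].
rewrite (lin_sum (tlift_linear bf)); apply: eq_bigr => p _.
by rewrite tlift_pi // /tsum big_seq1.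
Qed.

Lemma lin_tmap U V U' V' (f : U -> U') (g : V -> V') :
  lin f -> lin g -> lin (tmap f g).
Proof. by move=> hf hg; rewrite /tmap; lintac. Qed.

Lemma tmapT U V U' V' (f : U -> U') (g : V -> V') u v :
  lin f -> lin g -> tmap f g (u ⊗ v) = f u ⊗ g v.
Proof. by move=> hf hg; rewrite /tmap tliftT //; lintac. Qed.

Lemma spans_id V : spans (fun v : V => v).
Proof. by move=> v P _ _; apply. Qed.

Lemma tens_eq U V W (f g : U ⊗ V -> W) : lin f -> lin g ->
  (forall u v, f (u ⊗ v) = g (u ⊗ v)) -> forall t, f t = g t.
Proof.
move=> hf hg h; apply: (spans_ext (spans_tens (@spans_id U) (@spans_id V)) hf hg).
by case.
Qed.

(** Injectivity of a tensor product of maps is always obtained from linear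
    retractions of the factors. *)
Lemma tmapK U V U' V' (f : U -> U') (g : V -> V') f' g' :
  lin f -> lin g -> lin f' -> lin g' -> cancel f f' -> cancel g g' ->
  cancel (tmap f g) (tmap f' g').
Proof.
move=> lf lg lf' lg' fK gK.
have h := lin_tmap lf lg; have h' := lin_tmap lf' lg'.
by apply: tens_eq => [|//|u v]; [lintac | rewrite !tmapT // fK gK].
Qed.

(** Replaces the choice operator by any explicit preimage. *)
Lemma preimage_ofE U V (f : U -> V) u y :
  injective f -> f u = y -> preimage_of f y = u.
Proof.
move=> fI fu; apply: fI; rewrite fu.
exact: (@xgetPex _ 0 [set x | f x = y]%classic (ex_intro _ u fu)).
Qed.

Lemma image_spans U V W I (e : I -> U) (f : W -> V) (g : U -> V) :
  lin f -> lin g -> spans e -> (forall i, exists w, f w = g (e i)) ->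
  forall u, exists w, f w = g u.
Proof.
move=> hf hg he h u; apply: (he u (fun u => exists w, f w = g u)) => //.
  by exists 0; rewrite !lin0.
by move=> a x y [w hw] [w' hw']; exists (a *: w + w'); rewrite hf hg hw hw'.
Qed.

(** Uniqueness of preimages under an injective linear map makes the chosen
    preimage depend linearly on its argument. *)
Lemma lin_preimage_of U V W (f : W -> V) (g : U -> V) :
  lin f -> injective f -> lin g -> (forall u, exists w, f w = g u) ->
  lin (fun u => preimage_of f (g u)).
Proof.
move=> hf fI hg h a x y; have [u hu] := h x; have [v hv] := h y.
rewrite (preimage_ofE fI hu) (preimage_ofE fI hv); apply: preimage_ofE => //.
by rewrite hf hg hu hv.
Qed.

End Span.

(** * Algebras presented by quantum commutation relations *)

(** Orthogonality of the characters of the cyclic group of order [N]. *)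
Lemma fourier (F : fieldType) (N : nat) (q : F) : N.-primitive_root q ->
  forall n m : nat, N%:R^-1 * \sum_(k < N) q ^+ (k * n) * q ^- (k * m)
                    = (n == m %[mod N])%:R.
Proof.
move=> pq n m; have N0 := prim_order_gt0 pq.
have q0 k : q ^+ k != 0 by rewrite expf_neq0 // (prim_root_eq0 pq) -lt0n.
have -> : \sum_(k < N) q ^+ (k * n) * q ^- (k * m)
        = \sum_(k < N) (q ^+ n / q ^+ m) ^+ k.
  by apply: eq_bigr => k _; rewrite exprMn exprVn -!exprM ![(k * _)%N]mulnC.
set r := _ / _; rewrite -(eq_prim_root_expr pq).
have rN : r ^+ N = 1.
  by rewrite exprMn exprVn -!exprM ![(_ * N)%N]mulnC !exprM
     (prim_expr_order pq) !expr1n divr1.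
have [e|ne] := eqVneq.
  rewrite /r e divff // (eq_bigr (fun=> 1)) => [|k _]; last by rewrite expr1n.
  by rewrite sumr_const card_ord mulVf // (prim_root_natf_neq0 pq).
have r1 : r - 1 != 0.
  rewrite subr_eq0; apply: contraNneq ne => r1; apply/eqP.
  by rewrite -[LHS](divfK (q0 m)) -/r r1 mul1r.
apply/eqP; rewrite mulf_eq0; apply/orP; right.
by rewrite -(mulrI_eq0 _ (lregP r1)) -subrX1 rN subrr.
Qed.

(* Algebra structure on a subalgebra, so that it can be the target of the
   universal property of a presentation. *)
Section Subalgebra.
Variables (F : fieldType) (T : algType F) (S : subalgClosed T).

Record subalgebra := Subalgebra {
  subalg_val : T;
  subalg_valP : subalg_val \in (S : {pred T})
}.

HB.instance Definition _ := [isSub for subalg_val].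
HB.instance Definition _ := [Choice of subalgebra by <:].
HB.instance Definition _ := [SubChoice_isSubAlgebra of subalgebra by <:].

HB.instance Definition _ :=
  GRing.RMorphism.copy subalg_val (val : subalgebra -> T).
HB.instance Definition _ :=
  GRing.Linear.copy subalg_val (val : subalgebra -> T).

End Subalgebra.

(** The presentation gives a map [f] from [T] to the subalgebra [S].  Followed
    by the inclusion it fixes the generators, so it is the identity. *)
Lemma presented_generated (F : fieldType) (N d : nat) (z : F) (T : algType F) (x g : T) :
  qpresented N d z x g -> forall S : {pred T}, GRing.subalg_closed S ->
  x \in S -> g \in S -> forall t, t \in S.
Proof.
move=> [[rg rx rc] ex uq] S SC xS gS t.
pose SA : subalgClosed T := HB.pack S (GRing.isSubalgClosed.Build F T S SC).
pose x' := @Subalgebra F T SA x xS; pose g' := @Subalgebra F T SA g gS.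
have [|f [fx fg]] := ex (subalgebra SA) x' g'.
  split; apply: val_inj.
  - by rewrite rmorphXn rmorph1.
  - by rewrite rmorphXn rmorph0.
  - by rewrite linearZ !rmorphM.
have h : @subalg_val F T SA \o f =1 idfun.
  by apply: uq; rewrite /= ?fx ?fg.
by rewrite -[t]h; apply: subalg_valP.
Qed.

Lemma span_subalg (F : fieldType) (T : algType F) I (e : I -> T) :
  span e 1 -> (forall i j, span e (e i * e j)) ->
  GRing.subalg_closed [pred t | `[< span e t >]].
Proof.
move=> e1 eM; split; first exact/asboolP.
  by move=> a x y /asboolP hx /asboolP hy; apply/asboolP; exact: span_lin.
move=> x y /asboolP hx /asboolP hy; apply/asboolP.
apply: (hx (fun x => span e (x * y))) => [|a u v hu hv|i].
- by rewrite mul0r; apply: span0.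
- by rewrite mulrDl -scalerAl; apply: span_lin.
apply: (hy (fun y => span e (e i * y))) => [|a u v hu hv|j].
- by rewrite mulr0; apply: span0.
- by rewrite mulrDr -scalerAr; apply: span_lin.
exact: eM.
Qed.

Lemma spans_cyclic (F : fieldType) (T : algType F) (g : T) :
  generates_algebra g -> spans (fun n => g ^+ n).
Proof.
move=> gen t; apply/asboolP.
apply: (gen [pred t | `[< span (fun n => g ^+ n) t >]]); last first.
  by apply/asboolP; exact: (span_mem (e := fun n => g ^+ n) 1%N).
apply: span_subalg => [|i j]; first exact: (span_mem (e := fun n => g ^+ n) 0%N).
by rewrite -exprD; exact: (span_mem (e := fun n => g ^+ n)).
Qed.

(** Moving powers of [g] past powers of [x]. *)
Lemma qcommX (F : fieldType) (T : algType F) (z : F) (x g : T) :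
  g * x = z *: (x * g) -> forall i j,
  g ^+ j * x ^+ i = z ^+ (j * i) *: (x ^+ i * g ^+ j).
Proof.
move=> c i j; elim: j => [|j IHj]; first by rewrite scale1r !expr0 mul1r mulr1.
have c1 : g * x ^+ i = z ^+ i *: (x ^+ i * g).
  elim: i {IHj} => [|i IHi]; first by rewrite scale1r mulr1 mul1r.
  have -> : g * x ^+ i.+1 = (g * x) * x ^+ i by rewrite exprS mulrA.
  have -> : x ^+ i.+1 * g = x * (x ^+ i * g) by rewrite exprS mulrA.
  by rewrite c -scalerAl -mulrA IHi -scalerAr scalerA -exprS.
have -> : g ^+ j.+1 * x ^+ i = g ^+ j * (g * x ^+ i) by rewrite exprSr mulrA.
by rewrite c1 -scalerAr mulrA IHj -scalerAl scalerA -exprD -mulrA -exprSr mulSn.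
Qed.

Lemma spans_presented (F : fieldType) (N d : nat) (z : F) (T : algType F) (x g : T) :
  qpresented N d z x g -> spans (fun ij : nat * nat => x ^+ ij.1 * g ^+ ij.2).
Proof.
move=> P t; have [[_ _ c] _ _] := P; pose e (ij : nat * nat) := x ^+ ij.1 * g ^+ ij.2.
apply/asboolP; apply: (presented_generated P (S := [pred t | `[< span e t >]])).
- apply: span_subalg => [|[i j] [k l]].
    by have := span_mem (e := e) (0%N, 0%N); rewrite /e !expr0 mulr1.
  have -> : e (i, j) * e (k, l) = z ^+ (j * k) *: e ((i + k)%N, (j + l)%N).
    rewrite /e /= !exprD -[LHS]mulrA [_ * (x ^+ k * _)]mulrA (qcommX c).
    by rewrite -scalerAl -scalerAr !mulrA.
  exact: (spanZ _ (span_mem (e := e) (i + k, j + l)%N)).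
- by apply/asboolP; have := span_mem (e := e) (1%N, 0%N); rewrite /e mulr1.
- by apply/asboolP; have := span_mem (e := e) (0%N, 1%N); rewrite /e mul1r.
Qed.

Section Coordinates.
Variables (F : fieldType) (N d : nat) (z q : F) (T : algType F) (x g : T).
Hypothesis P : qpresented N d z x g.
Hypothesis d_gt0 : (0 < d)%N.
Hypothesis zN : z ^+ N = 1.
Hypothesis prim_q : N.-primitive_root q.

(** The representation with basis [v_0, ..., v_(d-1)] in which [x] shifts the
    basis and [g] acts on [v_i] by [q ^+ k * z ^+ i].  As [x ^+ i' * g ^+ j']
    sends [v_0] to [q ^+ (k * j')] times [v_i'], the coordinates of the image of
    [v_0] separate the powers of [x]. *)
Lemma shift_repr k : exists phi : nat -> T -> F^o,
  (forall i, lin (phi i)) /\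
  forall i i' j', (i < d)%N -> phi i (x ^+ i' * g ^+ j') = (q ^+ (k * j')) *+ (i == i').
Proof.
have [_ ex _] := P; case: d d_gt0 ex => // n _ ex.
pose X : 'M[F]_n.+1 := \matrix_(i, j) (i == j.+1 :> nat)%:R.
pose dg (m : nat) : 'rV[F]_n.+1 := \row_i (q ^+ (k * m) * z ^+ (i * m)).
pose G : 'M[F]_n.+1 := diag_mx (dg 1%N).
have XE m : X ^+ m = \matrix_(i, j) (i == j + m :> nat)%N%:R.
  elim: m => [|m IHm]; first by apply/matrixP => i j; rewrite !mxE addn0.
  apply/matrixP => i j; rewrite exprS IHm !mxE.
  have [le|lt] := ltnP (j + m) n.+1; last first.
    rewrite big1 => [|l _]; last first.
      rewrite !mxE; case: eqP => [_|]; rewrite ?mul0r // mul1r.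
      by case: eqP => // e; have := ltn_ord l; rewrite e ltnNge lt.
    case: eqP => // e; have := ltn_ord i; rewrite e addnS ltnNge.
    by rewrite (leq_trans lt).
  rewrite (bigD1 (Ordinal le)) //= !mxE /= eqxx mulr1 addnS big1 ?addr0 // => l nl.
  rewrite !mxE; case: (l =P _ :> nat) => [e|]; last by rewrite mulr0.
  by case/eqP: nl; apply: val_inj.
have GE m : G ^+ m = diag_mx (dg m).
  elim: m => [|m IHm].
    by apply/matrixP => i j; rewrite !mxE !muln0 mulr1.
  rewrite exprS IHm -mulmxE mulmx_diag; congr diag_mx; apply/rowP => i; rewrite !mxE.
  by rewrite mulrACA -!exprD !muln1 !mulnS.
have [|f [fx fg]] := ex _ X G.
  split.
  - rewrite GE; apply/matrixP => i j; rewrite !mxE ![(_ * N)%N]mulnC !exprM.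
    by rewrite zN (prim_expr_order prim_q) !expr1n mulr1.
  - rewrite XE; apply/matrixP => i j; rewrite !mxE.
    by case: eqP => // e; have := ltn_ord i; rewrite e ltnNge leq_addl.
  - apply/matrixP => i j; rewrite -!mulmxE mul_diag_mx mul_mx_diag !mxE !muln1.
    case: eqP => [->|]; last by rewrite !(mulr0, mul0r).
    by rewrite mul1r mulr1 exprS mulrCA.
exists (fun i t => f t (inord i) 0); split=> [i a t u|i i' j' lt].
  by rewrite linearP !mxE.
rewrite rmorphM !rmorphXn /= fx fg XE GE -mulmxE mul_mx_diag !mxE inordK //.
rewrite add0n mul0n mulr1 eq_sym.
by case: eqP; rewrite ?mul0r ?mul1r.
Qed.

(** Fourier inversion over the representations [shift_repr k], [k < N],
    separates the powers of [g] as well. *)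
Lemma coordinates : exists lam : nat -> nat -> T -> F^o,
  (forall i j, lin (lam i j)) /\
  forall i j i' j', (i < d)%N ->
    lam i j (x ^+ i' * g ^+ j') = ((i == i') && (j == j' %[mod N]))%:R.
Proof.
have [phi phiP] := choice shift_repr.
exists (fun i j t => N%:R^-1 * \sum_(k < N) q ^- (k * j) * phi k i t).
split=> [i j a t u|i j i' j' lt].
  rewrite -[a *: (_ * _)]/(a * (_ * _)) [a * _]mulrCA -mulrDr; congr (_ * _).
  rewrite mulr_sumr -big_split; apply: eq_bigr => k _.
  by rewrite (phiP k).1 mulrDr mulrCA.
under eq_bigr => k _ do rewrite (phiP k).2 //.
case: eqP => _ /=; last by rewrite big1 ?mulr0 // => k _; rewrite mulr0.
by rewrite eq_sym -(fourier prim_q); congr (_ * _); apply: eq_bigr => k _; rewrite mulrC.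
Qed.

End Coordinates.

(** * Comultiplication of monomials *)

Definition tens_mul (F : fieldType) (S T : algType F) (s t : S ⊗ T) : S ⊗ T :=
  \sw_(a, b <- s) \sw_(c, d <- t) (a * c) ⊗ (b * d).

Lemma bilin_tens_mul (F : fieldType) (S T : algType F) : bilin (@tens_mul F S T).
Proof. by rewrite /tens_mul; lintac. Qed.
#[export] Hint Resolve bilin_tens_mul : lin.

Lemma tens_mulT (F : fieldType) (S T : algType F) (a c : S) (b d : T) :
  tens_mul (a ⊗ b) (c ⊗ d) = (a * c) ⊗ (b * d).
Proof. by rewrite /tens_mul !tliftT //; lintac. Qed.

(** Gaussian binomial coefficients, by the Pascal rule that multiplying a power
    of the coproduct of [x] by this coproduct on the right produces. *)
Fixpoint qbin (R : pzRingType) (z : R) (n k : nat) : R :=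
  match n, k with
  | _, 0 => 1
  | 0, _.+1 => 0
  | n'.+1, k'.+1 => qbin z n' k + z ^+ (n' - k') * qbin z n' k'
  end.

Lemma qbin0 (R : pzRingType) (z : R) n : qbin z n 0 = 1.
Proof. by case: n. Qed.

Lemma qbin_small (R : pzRingType) (z : R) n k : (n < k)%N -> qbin z n k = 0.
Proof.
elim: n k => [|n IHn] [|k] //= lt; rewrite !IHn ?mulr0 ?addr0 //; exact: ltnW.
Qed.

Lemma qbinnn (R : pzRingType) (z : R) n : qbin z n n = 1.
Proof. by elim: n => //= n IHn; rewrite IHn subnn qbin_small // mulr1 add0r. Qed.

Section Grouplike.
Variables (F : fieldType) (H : hopfAlgebra F).
Implicit Types g h x y : H.

Lemma counit_scalar a : counit (a%:A : H) = a :> F.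
Proof. by rewrite linearZ rmorph1; apply: mulr1. Qed.

Lemma comul_mul h k : comul (h * k) = tens_mul (comul h) (comul k).
Proof. exact: comulM. Qed.

Lemma grouplikeX g n : comul g = g ⊗ g -> comul (g ^+ n) = (g ^+ n) ⊗ (g ^+ n).
Proof.
move=> gg; elim: n => [|n IHn]; first by rewrite !expr0 comul1.
by rewrite !exprS comul_mul IHn gg tens_mulT.
Qed.

Lemma grouplike_counit g g' : comul g = g ⊗ g -> g * g' = 1 -> counit g = 1 :> F.
Proof.
move=> gg gg'; have := counitl g.
rewrite gg tliftT; last lintac.
move=> /(congr1 (fun h => h * g')); rewrite -scalerAl gg' => /(congr1 counit).
by rewrite counit_scalar rmorph1.
Qed.

Lemma grouplike_antipode g g' :
  comul g = g ⊗ g -> g * g' = 1 -> antipode g = g'.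
Proof.
move=> gg gg'; have := antipodel g.
rewrite gg tliftT ?(grouplike_counit gg gg') ?scale1r; last lintac.
by move=> e; rewrite -[LHS]mulr1 -gg' mulrA e mul1r.
Qed.

Section SkewPrimitive.
Variables (x y : H) (z : F).
Hypothesis comul_y : comul y = y ⊗ y.
Hypothesis comul_x : comul x = y ⊗ x + x ⊗ 1.

Lemma skew_counit : counit y = 1 :> F -> counit x = 0 :> F.
Proof.
move=> e1; have := counitl x.
rewrite comul_x (linD (lin_tlift _)) ?tliftT ?e1 ?scale1r; try lintac.
move=> /(congr1 (fun h => h - x)); rewrite addrC addKr subrr => /(congr1 counit).
by rewrite counit_scalar raddf0.
Qed.

Hypothesis yx : y * x = z *: (x * y).

(** The quantum binomial formula: [y ⊗ x] and [x ⊗ 1] commute up to [z]. *)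
Lemma comul_skewX n : comul (x ^+ n) =
  \sum_(k < n.+1) qbin z n k *: ((x ^+ k * y ^+ (n - k)) ⊗ (x ^+ (n - k))).
Proof.
elim: n => [|n IHn]; first by rewrite big_ord1 expr0 scale1r mulr1 comul1.
pose t k : H ⊗ H := (x ^+ k * y ^+ (n.+1 - k)) ⊗ (x ^+ (n.+1 - k)).
rewrite exprSr comul_mul IHn comul_x.
have -> : tens_mul (\sum_(k < n.+1)
      qbin z n k *: ((x ^+ k * y ^+ (n - k)) ⊗ (x ^+ (n - k)))) (y ⊗ x + x ⊗ 1)
    = \sum_(k < n.+1)
        (qbin z n k *: t k + (z ^+ (n - k) * qbin z n k) *: t k.+1).
  rewrite (lin_sum (f := (@tens_mul F H H)^~ _)); last lintac.
  apply: eq_bigr => k _; have le : (k <= n)%N by rewrite -ltnS.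
  rewrite (linZ (f := (@tens_mul F H H)^~ _)); last lintac.
  rewrite (linD (f := @tens_mul F H H _)); last lintac.
  rewrite !tens_mulT scalerDr /t subSS subSn //; congr (_ + _).
    by rewrite -mulrA -!exprSr.
  rewrite mulr1 -mulrA.
  have := qcommX yx 1 (n - k); rewrite expr1 muln1 => ->.
  rewrite -scalerAr mulrA -exprSr (linZ (f := (@tensor F H H)^~ _)); last lintac.
  by rewrite scalerA mulrC.
rewrite big_split /= big_ord_recl [RHS]big_ord_recl -addrA !qbin0; congr (_ + _).
under [RHS]eq_bigr => k _ do rewrite /= scalerDl.
rewrite big_split /=; congr (_ + _).
rewrite [RHS]big_ord_recr /= qbin_small // scale0r addr0.
exact: eq_bigr.
Qed.

End SkewPrimitive.
End Grouplike.

Section Taft.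
Variables (F : fieldType) (N d m : nat) (z : F) (H : hopfAlgebra F) (x g : H).
Hypothesis T : is_taft N d z m x g.
Hypotheses (N_gt0 : (0 < N)%N) (d_gt0 : (0 < d)%N).

Let rels : qrelations N d z x g. Proof. by case: T => [[]]. Qed.

Lemma taft_gN : g ^+ N = 1. Proof. by case: rels. Qed.
Lemma taft_xd : x ^+ d = 0. Proof. by case: rels. Qed.
Lemma taft_gx : g * x = z *: (x * g). Proof. by case: rels. Qed.

Lemma taft_x_ge n : (d <= n)%N -> x ^+ n = 0.
Proof. by move=> le; rewrite -(subnK le) exprD taft_xd mulr0. Qed.

Lemma taft_spans : spans (fun ij : nat * nat => x ^+ ij.1 * g ^+ ij.2).
Proof. by case: T => P _ _; apply: (spans_presented P). Qed.

Lemma taft_g_inv : g * g ^+ N.-1 = 1.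
Proof. by rewrite -exprS prednK // taft_gN. Qed.

Lemma taft_comul_g n : comul (g ^+ n) = (g ^+ n) ⊗ (g ^+ n).
Proof. by apply: grouplikeX; case: T. Qed.

Lemma taft_comul n j : comul (x ^+ n * g ^+ j) =
  \sum_(k < n.+1) qbin (z ^+ m) n k *:
    ((x ^+ k * g ^+ (m * (n - k) + j)) ⊗ (x ^+ (n - k) * g ^+ j)).
Proof.
have [_ _ dx] := T.
have c : g ^+ m * x = z ^+ m *: (x * g ^+ m).
  by have := qcommX taft_gx 1 m; rewrite muln1.
rewrite comul_mul (comul_skewX dx c) taft_comul_g.
rewrite (lin_sum (f := (@tens_mul F H H)^~ _)); last lintac.
apply: eq_bigr => k _.
rewrite (linZ (f := (@tens_mul F H H)^~ _)); last lintac.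
by rewrite tens_mulT -mulrA -exprM -exprD.
Qed.

Lemma taft_counit_g : counit g = 1 :> F.
Proof. by apply: (grouplike_counit _ taft_g_inv); case: T. Qed.

Lemma taft_counit n j : counit (x ^+ n * g ^+ j) = (n == 0)%N%:R :> F.
Proof.
have gm : counit (g ^+ m) = 1 :> F by rewrite rmorphXn /= taft_counit_g expr1n.
have cx : counit x = 0 :> F by apply: skew_counit gm; case: T.
by rewrite rmorphM !rmorphXn /= taft_counit_g cx expr1n mulr1 expr0n.
Qed.

End Taft.

(** * Cyclic group algebras and their pairing *)

Lemma sum_pick (F : fieldType) (V : lmodType F) N n (f : nat -> V) : (0 < N)%N ->
  \sum_(j < N) ((j == n %[mod N])%N%:R : F) *: f j = f (n %% N)%N.
Proof.
move=> N0; rewrite (bigD1 (Ordinal (ltn_pmod n N0))) //= modn_mod eqxx scale1r.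
rewrite big1 ?addr0 // => j nj; rewrite modn_small // (_ : (_ == _) = false) ?scale0r //.
by apply: contraNF nj => /eqP e; apply/eqP/val_inj.
Qed.

Section CyclicSubalgebra.
Variables (F : fieldType) (N d m : nat) (z q : F) (H : hopfAlgebra F) (x g : H).
Hypothesis T : is_taft N d z m x g.
Hypotheses (prim_q : N.-primitive_root q) (d_gt0 : (0 < d)%N) (zN : z ^+ N = 1).
Variables (A : hopfAlgebra F) (i : {lrmorphism A -> H}) (gA : A).
Hypothesis D : hopf_subalgebra_generated_by i gA g.

Let N_gt0 := prim_order_gt0 prim_q.

Lemma cyc_i n : i (gA ^+ n) = g ^+ n.
Proof. by case: D => _ _ e _; rewrite rmorphXn /= e. Qed.

Lemma cyc_gN : gA ^+ N = 1.
Proof. by case: D => _ iI _ _; apply: iI; rewrite cyc_i rmorph1 (taft_gN T). Qed.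

Lemma cyc_mod n : gA ^+ (n %% N) = gA ^+ n.
Proof. exact: expr_mod cyc_gN. Qed.

Lemma cyc_spans : spans (fun n => gA ^+ n).
Proof. by case: D => _ _ _; apply: spans_cyclic. Qed.

(** The coordinate functionals of the ambient algebra, restricted. *)
Lemma cyc_coordinates : exists al : nat -> A -> F^o,
  (forall j, lin (al j)) /\ forall j n, al j (gA ^+ n) = (j == n %[mod N])%:R.
Proof.
have P : qpresented N d z x g by case: T.
have [lam [ll lE]] := coordinates P d_gt0 zN prim_q.
exists (fun j a => lam 0%N j (i a)); split=> [j|j n]; first lintac.
by have := lE 0%N j 0%N n d_gt0; rewrite expr0 mul1r cyc_i.
Qed.

Lemma cyc_retraction : exists r : H -> A, lin r /\ cancel i r.
Proof.
have P : qpresented N d z x g by case: T.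
have [lam [ll lE]] := coordinates P d_gt0 zN prim_q.
exists (fun h => \sum_(j < N) (lam 0%N j h : F) *: gA ^+ j).
have l : lin (fun h => \sum_(j < N) (lam 0%N j h : F) *: gA ^+ j) by lintac.
split=> //; apply: (spans_ext cyc_spans); try lintac.
move=> n; under eq_bigr => j _.
  rewrite (_ : lam _ _ _ = (j == n %[mod N])%:R); last first.
    by have := lE 0%N j 0%N n d_gt0; rewrite expr0 mul1r cyc_i.
over.
by rewrite (sum_pick n (fun j => gA ^+ j) N_gt0) cyc_mod.
Qed.

(** The comultiplication of [A] is only known after mapping to [H], and the
    tensor square of the inclusion is injective because of the retraction. *)
Lemma cyc_comul n : comul (gA ^+ n) = (gA ^+ n) ⊗ (gA ^+ n).
Proof.
have [r [rl rK]] := cyc_retraction; have [[iD _] _ _ _] := D.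
have il : lin i by lintac.
apply: (can_inj (tmapK il il rl rl rK rK)).
by rewrite -[LHS]iD cyc_i (taft_comul_g T) tmapT // cyc_i.
Qed.

Lemma cyc_counit n : counit (gA ^+ n) = 1 :> F.
Proof.
have [[_ ic] _ _ _] := D.
by rewrite -ic cyc_i rmorphXn /= (taft_counit_g T) // expr1n.
Qed.

Lemma cyc_inv n : gA ^+ n * gA ^+ (n * N.-1) = 1.
Proof. by rewrite -exprD -mulnS prednK // mulnC exprM cyc_gN expr1n. Qed.

Lemma cyc_antipode n : antipode (gA ^+ n) = gA ^+ (n * N.-1).
Proof. by apply: grouplike_antipode (cyc_inv n); rewrite cyc_comul. Qed.

Lemma cyc_antipodeK (a : A) : antipode (antipode a) = a.
Proof.
move: a; apply: (spans_ext cyc_spans); try lintac.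
move=> n; rewrite !cyc_antipode.
have e := cyc_inv (n * N.-1); have e' := cyc_inv n.
by rewrite -[LHS]mul1r -{1}e' -mulrA e mulr1.
Qed.

End CyclicSubalgebra.

Section Copairing.
Variables (F : fieldType) (A B : hopfAlgebra F) (N : nat) (q : F) (gA : A) (gB : B).
Hypotheses (prim_q : N.-primitive_root q) (gAN : gA ^+ N = 1) (gBN : gB ^+ N = 1).

Let N_gt0 := prim_order_gt0 prim_q.

(** Summation over [0, ..., N - 1] in place of [1, ..., N], as all terms are
    periodic. *)
Lemma cyclic_copairingE : cyclic_copairing N q gA gB =
  \sum_(k < N) \sum_(l < N) (N%:R^-1 * q ^- (k * l)) *: ((gB ^+ k) ⊗ (gA ^+ l)).
Proof.
have shift (V : zmodType) (u : nat -> V) : u N = u 0%N ->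
    \sum_(1 <= k < N.+1) u k = \sum_(k < N) u k.
  move=> e; apply: (addrI (u 0%N)); rewrite -big_ltn // big_nat_recr //= e addrC.
  by rewrite big_mkord.
rewrite /cyclic_copairing shift; last first.
  apply: eq_bigr => l _; rewrite gBN expr0 mul0n exprM (prim_expr_order prim_q).
  by rewrite expr1n.
rewrite scaler_sumr; apply: eq_bigr => k _.
rewrite shift; last first.
  by rewrite gAN expr0 muln0 mulnC exprM (prim_expr_order prim_q) expr1n.
by rewrite scaler_sumr; apply: eq_bigr => l _; rewrite scalerA.
Qed.

Lemma tlift_copairing (V : lmodType F) (f : B -> A -> V) : bilin f ->
  tlift f (cyclic_copairing N q gA gB) =
  \sum_(k < N) \sum_(l < N) (N%:R^-1 * q ^- (k * l)) *: f (gB ^+ k) (gA ^+ l).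
Proof.
move=> bf; have lf := lin_tlift bf.
rewrite cyclic_copairingE (lin_sum lf); apply: eq_bigr => k _.
by rewrite (lin_sum lf); apply: eq_bigr => l _; rewrite (linZ lf) tliftT.
Qed.

(** Summing over [k] against the character [q ^- (k * l)] selects the index [l]
    congruent to [s]: this is how the inverse copairing turns values of the
    pairing back into group elements. *)
Lemma copairing_pickr (V : lmodType F) (f : B -> A -> V) (v : nat -> V) s :
  bilin f -> (forall n, v (n %% N)%N = v n) ->
  (forall k l, f (gB ^+ k) (gA ^+ l) = q ^+ (k * s) *: v l) ->
  tlift f (cyclic_copairing N q gA gB) = v s.
Proof.
move=> bf vN fE; rewrite tlift_copairing // exchange_big /= -(vN s) -sum_pick //.
apply: eq_bigr => l _; rewrite eq_sym -(fourier prim_q) mulr_sumr scaler_suml.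
by apply: eq_bigr => k _; rewrite fE scalerA -mulrA [_^-1 * q ^+ _]mulrC.
Qed.

Lemma copairing_pickl (V : lmodType F) (f : B -> A -> V) (v : nat -> V) s :
  bilin f -> (forall n, v (n %% N)%N = v n) ->
  (forall k l, f (gB ^+ k) (gA ^+ l) = q ^+ (l * s) *: v k) ->
  tlift f (cyclic_copairing N q gA gB) = v s.
Proof.
move=> bf vN fE; rewrite tlift_copairing // -(vN s) -sum_pick //.
apply: eq_bigr => k _; rewrite eq_sym -(fourier prim_q) mulr_sumr scaler_suml.
by apply: eq_bigr => l _; rewrite fE scalerA -mulrA [_^-1 * q ^+ _]mulrC [(k * l)%N]mulnC.
Qed.

End Copairing.

Section Pairing.
Variables (F : fieldType) (N : nat) (q : F) (A B : hopfAlgebra F) (gA : A) (gB : B).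
Hypotheses (prim_q : N.-primitive_root q) (gAN : gA ^+ N = 1) (gBN : gB ^+ N = 1).
Hypotheses (spansA : spans (fun n => gA ^+ n)) (spansB : spans (fun n => gB ^+ n)).
Hypotheses (comul_gA : forall n, comul (gA ^+ n) = (gA ^+ n) ⊗ (gA ^+ n)).
Hypotheses (comul_gB : forall n, comul (gB ^+ n) = (gB ^+ n) ⊗ (gB ^+ n)).
Hypotheses (counit_gA : forall n, counit (gA ^+ n) = 1 :> F).
Hypotheses (counit_gB : forall n, counit (gB ^+ n) = 1 :> F).
Variable omega : {scalar (A ⊗ B)%type}.
Hypothesis omegaE : forall n m, omega ((gA ^+ n) ⊗ (gB ^+ m)) = q ^+ (n * m).

Lemma cyclic_hopf_pairing : hopf_pairing omega.
Proof.
have ext := fun (C : hopfAlgebra F) (e : nat -> C) f g =>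
  @spans_ext F C F^o nat e f g.
split.
- move=> a a' b.
  move: a; apply: (ext _ _ _ _ spansA) => [||n]; try lintac.
  move: a'; apply: (ext _ _ _ _ spansA) => [||m]; try lintac.
  move: b; apply: (ext _ _ _ _ spansB) => [||k]; try lintac.
  rewrite comul_gB tliftT; last lintac.
  by rewrite -exprD !omegaE -exprD mulnDl addnC.
- apply: (ext _ _ _ _ spansB) => [||k]; try lintac.
  by rewrite counit_gB -(expr0 gA) omegaE.
- move=> a b b'.
  move: a; apply: (ext _ _ _ _ spansA) => [||n]; try lintac.
  move: b; apply: (ext _ _ _ _ spansB) => [||m]; try lintac.
  move: b'; apply: (ext _ _ _ _ spansB) => [||k]; try lintac.
  rewrite comul_gA tliftT; last lintac.
  by rewrite -exprD !omegaE -exprD mulnDr.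
- apply: (ext _ _ _ _ spansA) => [||k]; try lintac.
  by rewrite counit_gA -(expr0 gB) omegaE muln0.
Qed.

Lemma cyclic_inverse_copairing :
  inverse_copairing omega (cyclic_copairing N q gA gB).
Proof.
split.
- apply: (spans_ext spansA) => [||n]; try lintac.
  have pick := copairing_pickr prim_q gAN gBN.
  apply: (pick _ _ (fun n => gA ^+ n)) => // [|k|k l].
  + by lintac.
  + exact: expr_mod.
  + by rewrite omegaE mulnC.
- apply: (spans_ext spansB) => [||n]; try lintac.
  have pick := copairing_pickl prim_q gAN gBN.
  apply: (pick _ _ (fun n => gB ^+ n)) => // [|k|k l].
  + by lintac.
  + exact: expr_mod.
  + by rewrite omegaE.
Qed.

(** The copairing recovers [a] from the values of [omega] at [a]. *)
Lemma inverse_copairing_nondegenerate w :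
  inverse_copairing omega w -> Defs.nondegenerate omega.
Proof.
move=> [ha hb]; split=> [a h|b h].
- rewrite -[LHS]ha /tlift /tsum big1 // => p _.
  by rewrite h scale0r.
- rewrite -[LHS]hb /tlift /tsum big1 // => p _.
  by rewrite h scale0r.
Qed.

End Pairing.

(** The coordinate functionals of both sides, combined with the matrix of powers
    of [q]. *)
Lemma root_pairing_exists (F : fieldType) (N : nat) (q : F) (A B : hopfAlgebra F)
    (gA : A) (gB : B) (al : nat -> A -> F^o) (be : nat -> B -> F^o) :
  N.-primitive_root q ->
  (forall j, lin (al j)) -> (forall j, lin (be j)) ->
  (forall j n, al j (gA ^+ n) = (j == n %[mod N])%:R) ->
  (forall j n, be j (gB ^+ n) = (j == n %[mod N])%:R) ->
  exists omega : {scalar (A ⊗ B)%type},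
    forall n m, omega ((gA ^+ n) ⊗ (gB ^+ m)) = q ^+ (n * m).
Proof.
move=> pq la lb alE beE.
pose om a b : F^o := \sum_(i < N) \sum_(j < N) (al i a : F) * ((be j b : F) * q ^+ (i * j)).
have bo : bilin om by rewrite /om; lintac.
have lo : linear_for *%R (tlift om : (A ⊗ B)%type -> F) := lin_tlift bo.
pose o : {scalar (A ⊗ B)%type} := HB.pack (tlift om : (A ⊗ B)%type -> F)
  (GRing.isLinear.Build _ _ _ _ _ lo).
exists o => n m; rewrite [LHS](tliftT _ _ bo) /om.
have N0 := prim_order_gt0 pq.
transitivity (\sum_(i < N) ((i == n %[mod N])%N%:R : F) *:
   \sum_(j < N) ((j == m %[mod N])%N%:R : F) *: (q ^+ (i * j) : F^o)).
  apply: eq_bigr => i _; rewrite scaler_sumr; apply: eq_bigr => j _.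
  by rewrite alE beE.
under eq_bigr => i _ do rewrite (sum_pick m (fun j => q ^+ (i * j) : F^o) N0).
rewrite (sum_pick n (fun i => q ^+ (i * (m %% N)) : F^o) N0).
by apply/eqP; rewrite (eq_prim_root_expr pq) modnMml modnMmr.
Qed.

(** * Quantum lines *)

(** A truncated polynomial algebra in one variable, in Yetter-Drinfeld modules
    over a group algebra generated by [g].  The powers of the variable are the
    [e n] up to the twist [mu].  The scalar [a ^+ r] is the self-braiding of the
    variable, hence the parameter of the binomial coefficients, and the factor
    [mu ^- _] in the comultiplication compensates the twist of the
    multiplication.  The basis is indexed by all natural numbers, with [e n = 0]
    from [d] on, so that no formula needs a case distinction. *)
Record quantum_line (F : fieldType) (d : nat) (A : hopfAlgebra F) (g : A)
    (X : ydBialgData A) (e : nat -> X) (a : F) (r : nat) (mu : F) : Prop := {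
  ql_spans : spans e;
  ql_ge : forall n, (d <= n)%N -> e n = 0;
  ql_coord : exists kap : nat -> X -> F^o, (forall n, lin (kap n)) /\
    forall n m, (n < d)%N -> kap n (e m) = (n == m)%N%:R;
  ql_act_lin : bilin (@yd_act F A X);
  ql_act : forall j n, yd_act (g ^+ j) (e n) = a ^+ (j * n) *: e n;
  ql_coact_lin : lin (@yd_coact F A X);
  ql_coact : forall n, yd_coact (e n) = (g ^+ (r * n)) ⊗ e n;
  ql_mul_lin : lin (@yb_mul F A X);
  ql_mul : forall n m, yb_mul (e n ⊗ e m) = mu ^+ (n * m) *: e (n + m)%N;
  ql_one : yb_one X = e 0%N;
  ql_comul_lin : lin (@yb_comul F A X);
  ql_comul : forall n, yb_comul (e n) =
    \sum_(k < n.+1) (qbin (a ^+ r) n k * mu ^- (k * (n - k))) *: (e k ⊗ e (n - k)%N);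
  ql_counit_lin : lin (@yb_counit F A X : X -> F^o);
  ql_counit : forall n, yb_counit (e n) = (n == 0)%N%:R
}.

(** * The biproduct of a quantum line *)

(** The cocycle [n * m] is the coboundary of ['C(n, 2)]. *)
Lemma bin2D n m : 'C(n + m, 2) = ('C(n, 2) + 'C(m, 2) + n * m)%N.
Proof.
elim: n => [|n IHn]; first by rewrite addn0.
by rewrite addSn !binS !bin1 IHn mulSn; lia.
Qed.

Section Biproduct.
Variables (F : fieldType) (N d r : nat) (q mu : F) (H : hopfAlgebra F) (x g : H).
Hypothesis T : is_taft N d q r x g.
Hypotheses (prim_q : N.-primitive_root q) (d_gt0 : (0 < d)%N) (mu_neq0 : mu != 0).
Variables (B : hopfAlgebra F) (i : {lrmorphism B -> H}) (gB : B).
Hypothesis D : hopf_subalgebra_generated_by i gB g.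
Variables (L : ydBialgData B) (e : nat -> L).
Hypothesis Q : quantum_line d gB e q r mu.

Let qN : q ^+ N = 1 := prim_expr_order prim_q.
Let N_gt0 := prim_order_gt0 prim_q.
Let gi n := cyc_i D n.
Let comul_gB n : comul (gB ^+ n) = (gB ^+ n) ⊗ (gB ^+ n) := cyc_comul T prim_q d_gt0 qN D n.
Let act_lin := ql_act_lin Q.
Let coact_lin := ql_coact_lin Q.
Let mul_lin := ql_mul_lin Q.
Let comul_lin := ql_comul_lin Q.
Let counit_lin := ql_counit_lin Q.

Let spansP := spans_tens (ql_spans Q) (cyc_spans D).

Let mul_bilin : bilin (@bd_mul F (biproduct L) : L ⊗ B -> L ⊗ B -> L ⊗ B).
Proof. rewrite /=. lintac. Qed.

Let mulE n j m k : @bd_mul F (biproduct L) (e n ⊗ gB ^+ j) (e m ⊗ gB ^+ k)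
  = (q ^+ (j * m) * mu ^+ (n * m)) *: (e (n + m)%N ⊗ gB ^+ (j + k)).
Proof.
rewrite /= tliftT; last lintac.
rewrite tliftT; last lintac.
rewrite comul_gB tliftT; last lintac.
rewrite (ql_act Q) (linZ (lin_bilinr (e n) (bilin_tensor _ _))) (linZ mul_lin).
rewrite (ql_mul Q) scalerA -exprD.
by rewrite (linZ (f := (@tensor F L B)^~ _)) //; lintac.
Qed.

Let comul_linP : lin (@bd_comul F (biproduct L) : L ⊗ B -> _).
Proof. rewrite /=. lintac. Qed.

Let comulE n j : @bd_comul F (biproduct L) (e n ⊗ gB ^+ j) =
  \sum_(k < n.+1) (qbin (q ^+ r) n k * mu ^- (k * (n - k))) *:
    ((e k ⊗ gB ^+ (r * (n - k) + j)) ⊗ (e (n - k)%N ⊗ gB ^+ j)).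
Proof.
rewrite /= tliftT; last lintac.
rewrite (ql_comul Q).
match goal with |- tlift ?f _ = _ => have bf : bilin f by lintac end.
have l := lin_tlift bf.
rewrite (lin_sum l); apply: eq_bigr => k _; rewrite (linZ l) tliftT; last lintac.
congr (_ *: _); rewrite (ql_coact Q) tliftT; last lintac.
by rewrite comul_gB tliftT ?exprD; last lintac.
Qed.

(** The rescaling that removes the twist [mu]. *)
Let phi (kap : nat -> L -> F^o) (v : L) : H :=
  \sum_(n < d) (kap n v : F) *: (mu ^- 'C(n, 2) *: x ^+ n).

(** The isomorphism sends [e n ⊗ b] to [mu ^- 'C(n, 2) *: x ^+ n * b]; its
    inverse reads off the coordinates with respect to [x ^+ n * g ^+ j]. *)
Lemma biproduct_quantum_line : hopf_isomorphic (biproduct L) (bialg_of H).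
Proof.
have P : qpresented N d q x g by case: T.
have [kap [lk kE]] := ql_coord Q.
have lphi : lin (phi kap) by rewrite /phi; lintac.
have phiE n : phi kap (e n) = mu ^- 'C(n, 2) *: x ^+ n.
  have [le|lt] := leqP d n.
    by rewrite (ql_ge Q le) (taft_x_ge T le) scaler0 lin0.
  rewrite /phi (bigD1 (Ordinal lt)) //= kE // eqxx scale1r big1 ?addr0 // => k nk.
  by rewrite kE // (negPf nk : (k == n :> nat) = false) scale0r.
pose f0 (t : L ⊗ B) : H := \sw_(v, b <- t) phi kap v * i b.
have bf : bilin (fun v b => phi kap v * i b) by lintac.
have lf : lin f0 by rewrite /f0; lintac.
have fE n j : f0 (e n ⊗ gB ^+ j) = mu ^- 'C(n, 2) *: (x ^+ n * g ^+ j).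
  by rewrite /f0 tliftT // phiE gi -scalerAl.
pose f : {linear biproduct L -> bialg_of H} := HB.pack (f0 : biproduct L -> bialg_of H)
  (GRing.isLinear.Build _ _ _ _ (f0 : biproduct L -> bialg_of H) lf).
have [lam [ll lE]] := coordinates P d_gt0 qN prim_q.
pose h (t : H) : L ⊗ B := \sum_(k < d) \sum_(l < N)
   (lam k l t : F) *: (mu ^+ 'C(k, 2) *: (e k ⊗ gB ^+ l)).
have lh : lin h by rewrite /h; lintac.
have hE n j : h (x ^+ n * g ^+ j) = mu ^+ 'C(n, 2) *: (e n ⊗ gB ^+ j).
  have [le|lt] := leqP d n.
    rewrite (ql_ge Q le) (taft_x_ge T le) mul0r lin0 //.
    by rewrite (lin0 (lin_bilinl _ (bilin_tensor L B))) scaler0.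
  rewrite /h (bigD1 (Ordinal lt)) //= [X in _ + X]big1 ?addr0 => [|k nk]; last first.
    by rewrite big1 // => l _; rewrite lE // (negPf nk : (k == n :> nat) = false) scale0r.
  under eq_bigr => l _ do rewrite lE // eqxx /=.
  by rewrite (sum_pick j (fun l => mu ^+ _ *: (e n ⊗ gB ^+ l)) N_gt0) (cyc_mod T D).
have [f0K hK] : cancel f0 h /\ cancel h f0.
  have c n : mu ^- n * mu ^+ n = 1 by rewrite mulVf // expf_neq0.
  split.
    apply: (spans_ext spansP) => [| |[n j]] //=; first by lintac.
    by rewrite fE (linZ lh) hE scalerA c scale1r.
  apply: (spans_ext (taft_spans T)) => [| |[n j]] //=; first by lintac.
  by rewrite hE (linZ lf) fE scalerA mulrC c scale1r.
have fM (s t : L ⊗ B) : f0 (@bd_mul F (biproduct L) s t) = f0 s * f0 t.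
  move: s t; apply: (bilin_ext spansP spansP) => [||[n j] [m k]].
  - by lintac.
  - by lintac.
  rewrite mulE (linZ lf) !fE bin2D !exprD !invfM.
  rewrite /= -scalerAl -scalerAr.
  have -> : x ^+ n * g ^+ j * (x ^+ m * g ^+ k)
          = q ^+ (j * m) *: (x ^+ n * x ^+ m * (g ^+ j * g ^+ k)).
    by rewrite -mulrA [g ^+ j * _]mulrA (qcommX (taft_gx T)) -scalerAl -scalerAr !mulrA.
  rewrite !scalerA; congr (_ *: _).
  have c : mu ^+ (n * m) * mu ^- (n * m) = 1 by rewrite mulfV // expf_neq0.
  by rewrite mulrACA c mulr1 mulrC.
have fD (s : L ⊗ B) : comul (f0 s) = tmap f0 f0 (@bd_comul F (biproduct L) s).
  have lt := lin_tmap lf lf.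
  move: s; apply: (spans_ext spansP) => [||[n j]].
  - by lintac.
  - by lintac.
  rewrite comulE (lin_sum lt) /= fE linearZ /= (taft_comul T) scaler_sumr.
  apply: eq_bigr => k _; rewrite (linZ lt) tmapT // !fE.
  rewrite (linZ (lin_bilinl _ (bilin_tensor H H))) (linZ (lin_bilinr _ (bilin_tensor H H))).
  rewrite !scalerA; congr (_ *: _).
  have le : (k <= n)%N by rewrite -ltnS.
  have -> : 'C(n, 2) = ('C(k, 2) + 'C(n - k, 2) + k * (n - k))%N.
    by rewrite -bin2D subnKC.
  rewrite !exprD !invfM.
  by rewrite mulrC -!mulrA; congr (_ * _); rewrite mulrA mulrC.
have fC (s : L ⊗ B) : counit (f0 s) = @bd_counit F (biproduct L) s :> F.
  move: s; apply: (@spans_ext F _ F^o _ _ _ _ spansP) => [||[n j]].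
  - by lintac.
  - by rewrite /=; lintac.
  rewrite fE linearZ /= (taft_counit T) // tliftT; last lintac.
  rewrite (ql_counit Q) (cyc_counit T prim_q D) mulr1.
  case: n => [|n]; last exact: mulr0.
  by rewrite expr0 invr1; apply: mulr1.
exists f; split => //.
- by exists h.
- rewrite [RHS](_ : _ = x ^+ 0 * g ^+ 0) ?mulr1 //.
  rewrite [LHS](_ : _ = f0 (e 0%N ⊗ gB ^+ 0)); last by rewrite -(ql_one Q).
  by rewrite fE /= !expr0 invr1 scale1r mulr1.
Qed.

End Biproduct.

(** * The braided equivalence on quantum lines *)

Section OmegaQuantumLine.
Variables (F : fieldType) (N d r s : nat) (q mu : F).
Variables (A B : hopfAlgebra F) (gA : A) (gB : B).
Hypotheses (prim_q : N.-primitive_root q) (gAN : gA ^+ N = 1) (gBN : gB ^+ N = 1).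
Hypothesis antipodeBK : forall b : B, antipode (antipode b) = b.
Variable omega : {scalar (A ⊗ B)%type}.
Hypothesis omegaE : forall n m, omega ((gA ^+ n) ⊗ (gB ^+ m)) = q ^+ (n * m).
Variables (X : ydBialgData A) (e : nat -> X).
Hypothesis Q : quantum_line d gA e (q ^+ s) r mu.

Let N_gt0 := prim_order_gt0 prim_q.
Let qN : q ^+ N = 1 := prim_expr_order prim_q.
Let w := cyclic_copairing N q gA gB.
Let L := Omega_bialg omega w X.
Let act_lin := ql_act_lin Q.
Let coact_lin := ql_coact_lin Q.
Let mul_lin := ql_mul_lin Q.
Let comul_lin := ql_comul_lin Q.
Let zeta := q ^+ (s * r).
Let zeta_neq0 n : zeta ^+ n != 0.
Proof. by rewrite !expf_neq0 // (prim_root_eq0 prim_q) -lt0n. Qed.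

Let antipodeVBK (b : B) : antipodeV (antipodeV b) = b.
Proof. by rewrite -{1}[b]antipodeBK !antipodeK. Qed.

Let lin_Omega2 : lin (@Omega2 F A X X).
Proof. by rewrite /Omega2; lintac. Qed.

Let Omega2E i j : @Omega2 F A X X (e i ⊗ e j) = zeta ^+ (i * j) *: (e i ⊗ e j).
Proof.
rewrite /Omega2 tliftT; last lintac.
rewrite (ql_coact Q) tliftT; last lintac.
rewrite (ql_act Q) (linZ (lin_bilinl _ (bilin_tensor _ _))); congr (_ *: _).
by rewrite -!exprM; congr (q ^+ _); lia.
Qed.

(** The map is diagonal on [e i ⊗ e j] with eigenvalues [N]-th roots of unity,
    so its [N]-th iterate is the identity. *)
Let Omega2_inj : injective (@Omega2 F A X X).
Proof.
have lit n : lin (iter n (@Omega2 F A X X)).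
  by elim: n => [|n IHn]; [apply: lin_id | apply: (lin_comp lin_Omega2 IHn)].
have itE n i j : iter n (@Omega2 F A X X) (e i ⊗ e j)
    = zeta ^+ (n * (i * j)) *: (e i ⊗ e j).
  elim: n => [|n IHn]; first by rewrite scale1r.
  by rewrite iterS IHn (linZ lin_Omega2) Omega2E scalerA -exprD mulSn addnC.
apply: (can_inj (g := iter N.-1 (@Omega2 F A X X))).
apply: (spans_ext (spans_tens (ql_spans Q) (ql_spans Q))) => [| |[i j]] //.
  by lintac.
by rewrite -iterSr prednK // itE /zeta -exprM mulnCA exprM qN expr1n scale1r.
Qed.

(** The pairing turns the degree [g ^+ (r * n)] into the character value
    [q ^+ (r * n)], and the copairing turns the character [q ^+ s] into the
    degree [g ^+ (s * n)].  The squared antipodes in the definition are trivial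
    on a group algebra. *)
Lemma Omega_quantum_line : @quantum_line F d B gB L e (q ^+ r) s (zeta * mu).
Proof.
have actE j n : @yd_act F B L (gB ^+ j) (e n) = (q ^+ r) ^+ (j * n) *: e n.
  rewrite /= (ql_coact Q) tliftT; last lintac.
  by rewrite antipodeVBK omegaE -exprM; congr (q ^+ _ *: _); lia.
have coactE n : @yd_coact F B L (e n) = (gB ^+ (s * n)) ⊗ e n.
  pose v k := (gB ^+ k) ⊗ e n.
  apply: (copairing_pickl prim_q gAN gBN (v := v)) => [|k|k l].
  - by lintac.
  - by rewrite /v expr_mod.
  - rewrite antipodeBK (ql_act Q) (linZ (lin_bilinr _ (bilin_tensor _ _))) -exprM.
    by congr (q ^+ _ *: _); lia.
pose cm n : X ⊗ X := \sum_(k < n.+1) (qbin ((q ^+ r) ^+ s) n k *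
  (zeta * mu) ^- (k * (n - k))) *: (e k ⊗ e (n - k)%N).
have cmE n : @Omega2 F A X X (cm n) = yb_comul (e n).
  have qq : (q ^+ r) ^+ s = (q ^+ s) ^+ r by rewrite -!exprM mulnC.
  rewrite (ql_comul Q) (lin_sum lin_Omega2); apply: eq_bigr => k _.
  rewrite (linZ lin_Omega2) Omega2E scalerA qq; congr (_ *: _).
  by rewrite exprMn invfM mulrAC mulrA mulfK.
split => //.
- exact: ql_spans Q.
- exact: ql_ge Q.
- exact: ql_coord Q.
- have h : bilin (fun (b : B) (v : X) =>
      \sw_(c, v0 <- yd_coact v) omega (c ⊗ b) *: v0) by lintac.
  split=> [v|b] k y y' /=; rewrite !antipodeVBK; [exact: h.1 | exact: h.2].
- by rewrite /L /=; lintac.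
- by rewrite /L /=; lintac.
- by move=> n m; rewrite /= Omega2E (linZ mul_lin) (ql_mul Q) scalerA exprMn.
- exact: ql_one Q.
- have im u : exists t, @Omega2 F A X X t = yb_comul u.
    move: u; apply: (image_spans lin_Omega2 comul_lin (ql_spans Q)) => n.
    by exists (cm n).
  exact: (lin_preimage_of lin_Omega2 Omega2_inj comul_lin im).
- by move=> n; apply: (preimage_ofE Omega2_inj); apply: cmE.
- exact: ql_counit_lin Q.
- exact: ql_counit Q.
Qed.

End OmegaQuantumLine.

(** * The coinvariants as a quantum line *)

Lemma sum_ord_first (V : nmodType) n (u : nat -> V) :
  (forall k, (k < n)%N -> u k.+1 = 0) -> \sum_(k < n.+1) u k = u 0%N.
Proof. by move=> u0; rewrite big_ord_recl big1 ?addr0 // => k _; apply: u0. Qed.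

Lemma sum_ord_last (V : nmodType) n (u : nat -> V) :
  (forall k, (k < n)%N -> u k = 0) -> \sum_(k < n.+1) u k = u n.
Proof.
move=> u0; rewrite big_ord_recr big1 => [|k _]; last exact: u0 (ltn_ord k).
exact: add0r.
Qed.

(** A span can be computed after an injective linear map, for example in the
    ambient space of a subspace. *)
Lemma span_inj (F : fieldType) (U V : lmodType F) I (f : U -> V) (e : I -> U) :
  lin f -> injective f -> forall u, span (fun i => f (e i)) (f u) -> span e u.
Proof.
move=> fl fI u fu P P0 Pl Pe.
have [u' [/fI <-]] : exists u', f u' = f u /\ P u'; last by [].
apply: (fu (fun v => exists u', f u' = v /\ P u')) => [|a x y [u1 [<- P1]] [u2 [<- P2]]|i].
- by exists 0; rewrite lin0.
- by exists (a *: u1 + u2); rewrite fl; split=> //; apply: Pl.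
- by exists (e i).
Qed.

Section Projection.
Variables (F : fieldType) (N d : nat) (z q : F) (H : hopfAlgebra F) (x g : H).
Hypothesis T : is_taft N d z 1 x g.
Hypotheses (prim_q : N.-primitive_root q) (d_gt0 : (0 < d)%N) (zN : z ^+ N = 1).
Variables (A : hopfAlgebra F) (i : {lrmorphism A -> H}) (gA : A).
Hypothesis D : hopf_subalgebra_generated_by i gA g.
Variable pi : {lrmorphism H -> A}.
Hypotheses (pi_g : pi g = gA) (pi_x : pi x = 0).

Let N_gt0 := prim_order_gt0 prim_q.
Let gAN : gA ^+ N = 1 := cyc_gN T D.
Let comul_gA n : comul (gA ^+ n) = (gA ^+ n) ⊗ (gA ^+ n) := cyc_comul T prim_q d_gt0 zN D n.
Let gi n := cyc_i D n.

Lemma piE n j : pi (x ^+ n * g ^+ j) = (n == 0)%N%:R *: gA ^+ j.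
Proof.
rewrite rmorphM !rmorphXn /= pi_x pi_g expr0n.
by case: n => [|n]; rewrite ?mul1r ?scale1r // mul0r scale0r.
Qed.

Lemma pi_x0 n j : pi (x ^+ n.+1 * g ^+ j) = 0.
Proof. by rewrite piE scale0r. Qed.

(** In the coproduct of a monomial, [pi] keeps only the term without [x] in the
    second factor. *)
Lemma pi_comul n j :
  tmap idfun pi (comul (x ^+ n * g ^+ j)) = (x ^+ n * g ^+ j) ⊗ (gA ^+ j).
Proof.
have l : lin (tmap (idfun : H -> H) pi) by apply: lin_tmap; lintac.
rewrite (taft_comul T) (lin_sum l).
pose u k := tmap idfun pi (qbin (z ^+ 1) n k *:
  ((x ^+ k * g ^+ (1 * (n - k) + j)) ⊗ (x ^+ (n - k) * g ^+ j))).
rewrite -[LHS]/(\sum_(k < n.+1) u k) sum_ord_last /u => [|k lt].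
  rewrite subnn qbinnn scale1r tmapT; try lintac.
  by rewrite piE scale1r muln0.
rewrite (linZ l) tmapT; try lintac.
rewrite -(prednK (_ : 0 < n - k)%N) ?subn_gt0 // pi_x0.
by rewrite (lin0 (lin_bilinr _ (bilin_tensor _ _))) scaler0.
Qed.

Lemma pi_hopf_morphism : hopf_morphism pi.
Proof.
split=> h.
  have l : lin pi by lintac.
  have lp := lin_tmap l l.
  move: h; apply: (spans_ext (taft_spans T)) => [||[n j]]; try lintac.
  rewrite /= (taft_comul T) (lin_sum lp).
  pose u k := tmap pi pi (qbin (z ^+ 1) n k *:
    ((x ^+ k * g ^+ (1 * (n - k) + j)) ⊗ (x ^+ (n - k) * g ^+ j))).
  rewrite -[RHS]/(\sum_(k < n.+1) u k) sum_ord_first /u => [|k lt].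
    rewrite qbin0 scale1r tmapT // !piE scale1r subn0.
    case: n {u} => [|n]; first by rewrite !scale1r comul_gA mul1n.
    by rewrite !scale0r linear0 (lin0 (lin_bilinr _ (bilin_tensor _ _))).
  by rewrite (linZ lp) tmapT // pi_x0 (lin0 (lin_bilinl _ (bilin_tensor _ _))) scaler0.
move: h; apply: (@spans_ext F H F^o _ _ _ _ (taft_spans T)) => [||[n j]]; try lintac.
rewrite /= (taft_counit T) // piE linearZ /= (cyc_counit T prim_q D).
by case: n => [|n]; [apply: mulr1 | apply: mul0r].
Qed.

Lemma taft_hopf_projection : hopf_projection i pi.
Proof.
have [iD iI _ _] := D; split=> //; first exact: pi_hopf_morphism.
apply: (spans_ext (cyc_spans D)); try lintac.
by move=> n; rewrite gi rmorphXn /= pi_g.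
Qed.

(** Applying [pi] to the antipode axiom for [x ^+ n * g ^+ j] leaves a single
    term, [pi] of the antipode of the monomial times [gA ^+ j]. *)
Lemma pi_antipode n j :
  pi (antipode (x ^+ n * g ^+ j)) = (n == 0)%N%:R *: gA ^+ (j * N.-1).
Proof.
have l : lin (tlift (fun h1 h2 : H => pi (antipode h1) * pi h2)).
  by apply: lin_tlift; lintac.
have e (t : H ⊗ H) : pi (\sw_(h1, h2 <- t) antipode h1 * h2)
    = \sw_(h1, h2 <- t) pi (antipode h1) * pi h2.
  move: t; apply: tens_eq => [||u v]; try lintac.
  by rewrite !tliftT ?rmorphM //; lintac.
have := congr1 pi (antipodel (x ^+ n * g ^+ j)).
rewrite e (taft_counit T) // linearZ rmorph1 /= (taft_comul T) (lin_sum l).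
pose u k := tlift (fun h1 h2 : H => pi (antipode h1) * pi h2)
  (qbin (z ^+ 1) n k *: ((x ^+ k * g ^+ (1 * (n - k) + j)) ⊗ (x ^+ (n - k) * g ^+ j))).
rewrite -[X in X = _]/(\sum_(k < n.+1) u k) sum_ord_last /u => [|k lt]; last first.
  rewrite (linZ l) tliftT; last lintac.
  by rewrite -(prednK (_ : 0 < n - k)%N) ?subn_gt0 // pi_x0 mulr0 scaler0.
rewrite subnn qbinnn scale1r tliftT; last lintac.
rewrite piE scale1r muln0 => eq.
by rewrite -[LHS]mulr1 -(cyc_inv T prim_q D j) mulrA eq -scalerAl mul1r.
Qed.

Lemma xK_coinvariant n : x ^+ n \in coinvariant pi.
Proof.
apply/asboolP; have := pi_comul n 0; rewrite !expr0 mulr1; apply.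
Qed.

Definition xK n : coinvariants pi := Coinvariant (xK_coinvariant n).

Let cv : coinvariants pi -> H := @coinv_val F H A pi.

Lemma lin_cv : lin cv.
Proof. exact: (lin_linear (val : coinvariants pi -> H)). Qed.

Lemma cv_inj : injective cv.
Proof. exact: val_inj. Qed.

(** The map [E] keeps of [h] the part whose degree in [g], as recorded by the
    coaction of [A], vanishes.  Its image is spanned by the powers of [x], and
    it fixes the coinvariants. *)
Lemma xK_spans : spans xK.
Proof.
move=> k; apply: (span_inj lin_cv cv_inj).
have [al [la alE]] := cyc_coordinates T prim_q d_gt0 zN D.
pose E (h : H) : H := \sw_(h', a <- tmap idfun pi (comul h)) (al 0%N a : F) *: h'.
have lt : lin (tmap (idfun : H -> H) pi) by apply: lin_tmap; lintac.
have lE : lin E by rewrite /E; lintac.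
have -> : cv k = E (cv k).
  have /asboolP kP := coinv_valP k.
  rewrite /E kP tliftT; last lintac.
  by rewrite -(expr0 gA) alE eqxx scale1r.
move: (cv k) => h.
apply: (taft_spans T h (P := fun h => span (fun n => cv (xK n)) (E h)))
  => [|a u v hu hv|[n j]].
- by rewrite lin0 //; apply: span0.
- by rewrite lE; apply: span_lin.
rewrite /= /E pi_comul tliftT; last lintac.
rewrite alE; case: eqP => [e|_]; last by rewrite scale0r; apply: span0.
rewrite scale1r -(expr_mod j (taft_gN T)) -e mod0n mulr1.
exact: (span_mem (e := fun n => cv (xK n))).
Qed.

Let X := K_bialg i pi.

Lemma xK_ge n : (d <= n)%N -> xK n = 0.
Proof. by move=> le; apply: cv_inj; rewrite (lin0 lin_cv); apply: (taft_x_ge T). Qed.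

(** Used for the injectivity of the inclusions of [A ⊗ K] and [K ⊗ K]. *)
Lemma cv_retraction : exists r : H -> coinvariants pi, lin r /\ cancel cv r.
Proof.
have P : qpresented N d z x g by case: T.
have [lam [ll lE]] := coordinates P d_gt0 zN prim_q.
pose r (h : H) : coinvariants pi := \sum_(n < d) (lam n 0%N h : F) *: xK n.
have lr : lin r by rewrite /r; lintac.
have lcv := lin_cv.
exists r; split=> //; apply: (spans_ext xK_spans) => [||n]; try lintac.
have [le|lt] := leqP d n; first by rewrite xK_ge // (lin0 lcv) (lin0 lr).
have lamE k : (k < d)%N -> lam k 0%N (cv (xK n)) = (k == n)%N%:R.
  by move=> ltk; have := lE k 0%N n 0%N ltk; rewrite eqxx andbT mulr1.
rewrite /r (bigD1 (Ordinal lt)) //= lamE // eqxx scale1r big1 ?addr0 // => k nk.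
by rewrite lamE // (negPf nk : (k == n :> nat) = false) scale0r.
Qed.

(** The structure maps of [K] are preimages of expressions in [H]; each
    expression is evaluated on the basis, where a preimage is visible.  In the
    iterated coproduct of [x ^+ n], [pi_antipode] leaves only the terms whose
    middle factor is a power of [g]; that power cancels the one from the first
    factor, so the binomial formula of [H] descends to [K]. *)
Lemma K_quantum_line : @quantum_line F d A gA X xK z 1 1.
Proof.
have lcv := lin_cv.
have P : qpresented N d z x g by case: T.
have [r [lr rK]] := cv_retraction.
pose tA : A ⊗ coinvariants pi -> A ⊗ H := tmap idfun cv.
pose tK : coinvariants pi ⊗ coinvariants pi -> H ⊗ H := tmap cv cv.
have lid (V : lmodType F) : lin (idfun : V -> V) by lintac.
have ltA : lin tA by apply: lin_tmap.
have ltK : lin tK by apply: lin_tmap.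
have tAI : injective tA by apply: (can_inj (tmapK _ _ _ lr _ rK)).
have tKI : injective tK by apply: (can_inj (tmapK _ _ lr lr rK rK)).
have antipode_g j : antipode (g ^+ j) = g ^+ (j * N.-1).
  apply: grouplike_antipode; first by rewrite (taft_comul_g T).
  by rewrite -!gi -rmorphM (cyc_inv T prim_q D) rmorph1.
pose fact (a : A) (k : coinvariants pi) :=
  \sw_(a1, a2 <- comul a) i a1 * cv k * antipode (i a2).
have bact : bilin fact by rewrite /fact; lintac.
have factE j n : fact (gA ^+ j) (xK n) = cv (z ^+ (j * n) *: xK n).
  rewrite /fact comul_gA tliftT; last lintac.
  rewrite gi antipode_g (linZ lcv) -[cv _]/(x ^+ n) (qcommX (taft_gx T)) -scalerAl -mulrA.
  by rewrite -!gi -rmorphM (cyc_inv T prim_q D) rmorph1 mulr1.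
pose fcoact (k : coinvariants pi) := \sw_(k1, k2 <- comul (cv k)) pi k1 ⊗ k2.
have lcoact : lin fcoact by rewrite /fcoact; lintac.
have fcoactE n : fcoact (xK n) = tA ((gA ^+ n) ⊗ xK n).
  have l : lin (tlift (fun k1 k2 : H => pi k1 ⊗ k2)) by apply: lin_tlift; lintac.
  rewrite /fcoact /tA tmapT // -[cv _]/(x ^+ n) -[x ^+ n in LHS]mulr1 -(expr0 g).
  rewrite (taft_comul T) (lin_sum l).
  pose u k := tlift (fun k1 k2 : H => pi k1 ⊗ k2)
    (qbin (z ^+ 1) n k *: ((x ^+ k * g ^+ (1 * (n - k) + 0)) ⊗ (x ^+ (n - k) * g ^+ 0))).
  rewrite -[LHS]/(\sum_(k < n.+1) u k) sum_ord_first /u => [|k lt].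
    rewrite qbin0 scale1r tliftT; last lintac.
    by rewrite piE scale1r subn0 mul1n addn0 mulr1.
  rewrite (linZ l) tliftT; last lintac.
  by rewrite pi_x0 (lin0 (lin_bilinl _ (bilin_tensor _ _))) scaler0.
pose fmul (t : coinvariants pi ⊗ coinvariants pi) := tlift (fun h k => cv h * cv k) t.
have lmul : lin fmul by rewrite /fmul; lintac.
have fmulE n m : fmul (xK n ⊗ xK m) = cv (1 ^+ (n * m) *: xK (n + m)).
  rewrite /fmul tliftT; last lintac.
  by rewrite expr1n scale1r -[RHS]/(x ^+ _) exprD.
pose fcomul (k : coinvariants pi) := \sw_(k1, k' <- comul (cv k)) \sw_(k2, k3 <- comul k')
        (k1 * i (pi (antipode k2))) ⊗ k3.
have lcomul : lin fcomul by rewrite /fcomul; lintac.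
have comulX n : comul (x ^+ n) =
    \sum_(k < n.+1) qbin z n k *: ((x ^+ k * g ^+ (n - k)) ⊗ (x ^+ (n - k))).
  rewrite -[x ^+ n]mulr1 -(expr0 g) (taft_comul T) expr1; apply: eq_bigr => k _.
  by rewrite mul1n addn0 mulr1.
have fcomulE n : fcomul (xK n) = tK (\sum_(k < n.+1)
    (qbin (z ^+ 1) n k * 1 ^- (k * (n - k))) *: (xK k ⊗ xK (n - k)%N)).
  rewrite (lin_sum ltK) /fcomul -[cv _]/(x ^+ n) comulX.
  match goal with |- tlift ?f _ = _ =>
    have lt : lin (tlift f) by apply: lin_tlift; lintac end.
  rewrite (lin_sum lt); apply: eq_bigr => k _; rewrite (linZ lt) (linZ ltK) {1}/tK tmapT //.
  rewrite expr1n invr1 mulr1 expr1; congr (_ *: _).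
  rewrite tliftT; last lintac.
  set p := (n - k)%N.
  pose f (k2 k3 : H) := (x ^+ k * g ^+ p * i (pi (antipode k2))) ⊗ k3.
  have lf : lin (tlift f) by apply: lin_tlift; rewrite /f; lintac.
  rewrite -[LHS]/(tlift f (comul (x ^+ p))) comulX (lin_sum lf).
  pose u m := tlift f (qbin z p m *: ((x ^+ m * g ^+ (p - m)) ⊗ (x ^+ (p - m)))).
  have bf : bilin f by rewrite /f; lintac.
  rewrite -[LHS]/(\sum_(m < p.+1) u m) sum_ord_first /u => [|m ltm].
    rewrite qbin0 scale1r tliftT // /f subn0 pi_antipode scale1r gi -mulrA.
    by rewrite -!gi -rmorphM (cyc_inv T prim_q D) rmorph1 mulr1.
  rewrite (linZ lf) tliftT // /f pi_antipode scale0r raddf0 mulr0.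
  by rewrite (lin0 (lin_bilinl _ (bilin_tensor _ _))) scaler0.
have imact a k : exists k', cv k' = fact a k.
  move: a; apply: (image_spans (g := fact^~ k) lcv (lin_bilinl _ bact) (cyc_spans D)) => j.
  move: k; apply: (image_spans lcv (lin_bilinr _ bact) xK_spans) => n.
  by rewrite factE; eexists.
have imcoact k : exists t, tA t = fcoact k.
  move: k; apply: (image_spans ltA lcoact xK_spans) => n; rewrite fcoactE; by eexists.
have immul t : exists k, cv k = fmul t.
  move: t; apply: (image_spans lcv lmul (spans_tens xK_spans xK_spans)) => -[n m].
  by rewrite fmulE; eexists.
have imcomul k : exists t, tK t = fcomul k.
  by move: k; apply: (image_spans ltK lcomul xK_spans) => n; rewrite fcomulE; eexists.
split.
- exact: xK_spans.
- exact: xK_ge.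
- have [lam [ll lE]] := coordinates P d_gt0 zN prim_q.
  exists (fun n k => lam n 0%N (cv k)); split=> [n|n m lt]; first lintac.
  by have := lE n 0%N m 0%N lt; rewrite eqxx andbT mulr1.
- split=> [k|a].
  + exact: (lin_preimage_of lcv cv_inj (lin_bilinl k bact) (imact^~ k)).
  + exact: (lin_preimage_of lcv cv_inj (lin_bilinr a bact) (imact a)).
- by move=> j n; apply: (preimage_ofE cv_inj); rewrite -factE.
- exact: (lin_preimage_of ltA tAI lcoact imcoact).
- by move=> n; rewrite mul1n; apply: (preimage_ofE tAI); rewrite -fcoactE.
- exact: (lin_preimage_of lcv cv_inj lmul immul).
- by move=> n m; apply: (preimage_ofE cv_inj); rewrite -fmulE.
- by apply: (preimage_ofE cv_inj); apply: expr0.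
- exact: (lin_preimage_of ltK tKI lcomul imcomul).
- by move=> n; apply: (preimage_ofE tKI); rewrite -fcomulE.
- by rewrite /=; lintac.
- by move=> n; have := taft_counit T N_gt0 n 0; rewrite mulr1.
Qed.

End Projection.

(** * The partial dualization *)

Lemma exprz_modn (F : fieldType) (N : nat) (q : F) (c : int) :
  N.-primitive_root q -> q ^ c = q ^+ `|(c %% N)%Z|%N.
Proof.
move=> pq; have N0 := prim_order_gt0 pq.
have q0 : q != 0 by rewrite (prim_root_eq0 pq) -lt0n.
rewrite {1}(divz_eq c N) expfzDr // mulrC -exprz_exp exprnP.
have -> : (`|(c %% N)%Z|%N : int) = (c %% N)%Z by rewrite gez0_abs // modz_ge0 // -lt0n.
by rewrite exprzAC -[q ^ N]exprnP (prim_expr_order pq) exp1rz mulr1.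
Qed.

Section PartialDualization.
Variables (F : fieldType) (N d m : nat) (q : F).
Hypotheses (prim_q : N.-primitive_root q) (d_gt0 : (0 < d)%N).
Variables (That Tcheck A B : hopfAlgebra F).
Variables (xh gh : That) (xc gc : Tcheck).
Hypothesis zN : (q ^+ m) ^+ N = 1.
Hypotheses (Th : is_taft N d (q ^+ m) 1 xh gh) (Tc : is_taft N d q m xc gc).
Variables (iA : {lrmorphism A -> That}) (gA : A) (iB : {lrmorphism B -> Tcheck}) (gB : B).
Hypothesis DA : hopf_subalgebra_generated_by iA gA gh.
Hypothesis DB : hopf_subalgebra_generated_by iB gB gc.

Let qN : q ^+ N = 1 := prim_expr_order prim_q.

Lemma taft_projection_exists : exists pi : {lrmorphism That -> A}, pi gh = gA /\ pi xh = 0.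
Proof.
have [[_ ex _] _ _] := Th.
have [|f [fx fg]] := ex A 0 gA; last by exists f.
split; first exact: (cyc_gN Th DA).
  by rewrite expr0n gtn_eqF.
by rewrite mulr0 mul0r scaler0.
Qed.

Lemma cyclic_pairing_exists : exists omega : {scalar (A ⊗ B)%type},
  forall n k : nat, omega ((gA ^+ n) ⊗ (gB ^+ k)) = q ^+ (n * k).
Proof.
have [al [la alE]] := cyc_coordinates Th prim_q d_gt0 zN DA.
have [be [lb beE]] := cyc_coordinates Tc prim_q d_gt0 qN DB.
exact: root_pairing_exists prim_q la lb alE beE.
Qed.

Variables (pi : {lrmorphism That -> A}) (omega : {scalar (A ⊗ B)%type}).
Hypotheses (pi_g : pi gh = gA) (pi_x : pi xh = 0).
Hypothesis omegaE : forall n k : nat, omega ((gA ^+ n) ⊗ (gB ^+ k)) = q ^+ (n * k).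

Let gAN : gA ^+ N = 1 := cyc_gN Th DA.
Let gBN : gB ^+ N = 1 := cyc_gN Tc DB.

Lemma taft_dualization_datum :
  partial_dualization_datum iA pi omega (cyclic_copairing N q gA gB).
Proof.
have w : inverse_copairing omega (cyclic_copairing N q gA gB).
  exact: (cyclic_inverse_copairing prim_q gAN gBN (cyc_spans DA) (cyc_spans DB) omegaE).
split=> //; last exact: inverse_copairing_nondegenerate w.
  exact: (taft_hopf_projection Th prim_q d_gt0 zN DA pi_g pi_x).
apply: cyclic_hopf_pairing omegaE.
- exact: cyc_spans DA.
- exact: cyc_spans DB.
- by move=> n; apply: (cyc_comul Th prim_q d_gt0 zN DA n).
- by move=> n; apply: (cyc_comul Tc prim_q d_gt0 qN DB n).
- by move=> n; apply: (cyc_counit Th prim_q DA n).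
- by move=> n; apply: (cyc_counit Tc prim_q DB n).
Qed.

Lemma taft_partial_dualization : hopf_isomorphic
  (partial_dualization iA pi omega (cyclic_copairing N q gA gB)) (bialg_of Tcheck).
Proof.
have QK := K_quantum_line Th prim_q d_gt0 zN DA pi_g pi_x.
have SB := cyc_antipodeK Tc prim_q d_gt0 qN DB.
have QL := Omega_quantum_line prim_q gAN gBN SB omegaE QK.
rewrite expr1 in QL.
apply: (biproduct_quantum_line Tc prim_q d_gt0 _ DB QL).
by rewrite mulr1 expf_neq0 // (prim_root_eq0 prim_q) -lt0n (prim_order_gt0 prim_q).
Qed.

End PartialDualization.

Theorem proposition5p5 (R : realType) (N d : nat) (zeta q : R[i]) (c : int)
  (dvd_dN : (d %| N)%N)
  (prim_zeta : d.-primitive_root zeta) (prim_q : N.-primitive_root q)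
  (q_c : q ^ c = zeta)
  (That Tcheck A B : hopfAlgebra R[i])
  (xhat ghat : That) (xcheck gcheck : Tcheck)
  (That_def : is_taft N d zeta 1 xhat ghat)
  (Tcheck_def : is_taft N d q `|(c %% N)%Z|%N xcheck gcheck)
  (iA : {lrmorphism A -> That}) (gA : A)
  (A_def : hopf_subalgebra_generated_by iA gA ghat)
  (iB : {lrmorphism B -> Tcheck}) (gB : B)
  (B_def : hopf_subalgebra_generated_by iB gB gcheck) :
  (exists pi : {lrmorphism That -> A}, pi ghat = gA /\ pi xhat = 0) /\
  (exists omega : {scalar (A ⊗ B)%type},
     forall n m : nat, omega ((gA ^+ n) ⊗ (gB ^+ m)) = q ^+ (n * m)) /\
  forall (pi : {lrmorphism That -> A}) (omega : {scalar (A ⊗ B)%type}),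
    pi ghat = gA -> pi xhat = 0 ->
    (forall n m : nat, omega ((gA ^+ n) ⊗ (gB ^+ m)) = q ^+ (n * m)) ->
    [/\ hopf_projection iA pi,
        partial_dualization_datum iA pi omega (cyclic_copairing N q gA gB)
      & hopf_isomorphic
          (partial_dualization iA pi omega (cyclic_copairing N q gA gB))
          (bialg_of Tcheck)].
Proof.
have d_gt0 := prim_order_gt0 prim_zeta.
have zN : (q ^+ `|(c %% N)%Z|%N) ^+ N = 1.
  by rewrite -exprM mulnC exprM (prim_expr_order prim_q) expr1n.
rewrite -q_c (exprz_modn _ prim_q) in That_def.
split; first exact: (taft_projection_exists d_gt0 That_def A_def).
split.
  exact: (cyclic_pairing_exists prim_q d_gt0 zN That_def Tcheck_def A_def B_def).
move=> pi omega pi_g pi_x omegaE.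
have D := taft_dualization_datum prim_q d_gt0 zN That_def Tcheck_def A_def B_def
  pi_g pi_x omegaE.
split=> //; first by case: D.
exact: (taft_partial_dualization prim_q d_gt0 zN That_def Tcheck_def A_def B_def
  pi_g pi_x omegaE).
Qed.
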